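(* Let $B, C, \lambda_1,\dots,\lambda_n\in\mathbb{R}\setminus\{0\}$, $E>1$, $a_1,\dots,a_n>0$, and $\alpha,\psi_1,\dots,\psi_n\in\mathbb{R}$ be constants. Let $I\subset\mathbb{R}$ be a connected open neighborhood of $0\in\mathbb{R}$ such that $$E\Big\{\prod_{k=1}^{n}(1+2a_kB\lambda_k s)\Big\}e^{2B\alpha s}-1>0\quad\text{and}\quad \frac{1}{a_j}+2\lambda_jBs>0$$ for every $j\in\{1,\dots,n\}$ and every $s\in I$. Define $r_1,\dots,r_n:I\to\mathbb{R}$ by $$r_j(s)=\sqrt{\frac{1}{a_j}+2\lambda_jBs}$$ and $\phi_1,\dots,\phi_n:I\to\mathbb{R}$ by $$\phi_j(s)=\psi_j+\int_0^s\frac{\lambda_j|B|}{\big(\frac{1}{a_j}+2\lambda_jBt\big)\sqrt{E\{\prod_{k=1}^{n}(1+2a_kB\lambda_kt)\}e^{2B\alpha t}-1}}\,dt.$$ Then the submanifold $L$ in $\mathbb{C}^n$ given by $$L=\Big\{(x_1r_1(s)e^{i\phi_1(s)},\dots,x_nr_n(s)e^{i\phi_n(s)})\ :\ \sum_{j=1}^n\lambda_jx_j^2=C,\ x_j\in\mathbb{R},\ s\in I\Big\}$$ is an immersed Lagrangian submanifold, and its position vector $F$ and mean curvature vector $H$ satisfy $CH\equiv\alpha F^{\perp}$.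
   Context: $\mathbb{C}^n\cong\mathbb{R}^{2n}$ carries its standard Euclidean metric, complex structure $J$ (multiplication by $i$) and symplectic form. $L$ is regarded as an immersed submanifold via the parametrization $((x_1,\dots,x_n),s)\mapsto(x_1r_1(s)e^{i\phi_1(s)},\dots,x_nr_n(s)e^{i\phi_n(s)})$ from $\{x\in\mathbb{R}^n:\sum_j\lambda_jx_j^2=C\}\times I$ to $\mathbb{C}^n$. $F$ is the position vector of $L$ in $\mathbb{C}^n$, $F^{\perp}$ is its orthogonal projection to the normal bundle of $L$, and $H$ is the mean curvature vector of $L$ (the trace of the second fundamental form). *)

(* Defs.v *)
From HB Require Import structures.
From mathcomp Require Import all_boot all_order all_algebra.
From mathcomp Require Import all_classical all_reals all_analysis.
Set Implicit Arguments.
Unset Strict Implicit.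
Unset Printing Implicit Defensive.
Import Order.TTheory GRing.Theory Num.Theory.
Import numFieldNormedType.Exports.
Local Open Scope classical_set_scope.
Local Open Scope ring_scope.

Definition dot (R : realType) N (v w : 'rV[R]_N) : R := (v *m w^T) 0 0.

Definition pd (R : realType) m N (i : 'I_m) (f : 'rV[R]_m -> 'rV[R]_N)
  : 'rV[R]_m -> 'rV[R]_N := fun y => 'D_(delta_mx 0 i) f y.

(* C^oo: all iterated partial derivatives exist and are continuous on the
   (open) set U. *)
Definition smooth_on (R : realType) m N (U : set 'rV[R]_m)
    (f : 'rV[R]_m -> 'rV[R]_N) : Prop :=
  forall (s : seq 'I_m) (y : 'rV[R]_m), U y ->
    {for y, continuous (foldr (@pd R m N) f s)} /\
    forall i : 'I_m, derivable (foldr (@pd R m N) f s) y (delta_mx 0 i).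

(* The rows are the partial derivatives of f at y: the row space is the image
   of the differential, and row_free says that the differential is injective. *)
Definition tangent_mx (R : realType) m N (f : 'rV[R]_m -> 'rV[R]_N)
    (y : 'rV[R]_m) : 'M[R]_(m, N) := \matrix_(i < m) pd i f y.

(* The last condition says that u maps open subsets of U to relatively open
   subsets of M, so that u is a homeomorphism onto an open subset of M. *)
Definition local_param (R : realType) m N (M : set 'rV[R]_N)
    (U : set 'rV[R]_m) (u : 'rV[R]_m -> 'rV[R]_N) : Prop :=
  [/\ open U,
      smooth_on U u,
      forall y, U y -> row_free (tangent_mx u y),
      {in U &, injective u}
    & forall V, open V -> V `<=` U ->
        exists W : set 'rV[R]_N, open W /\ u @` V = M `&` W].

Definition submanifold (R : realType) (m N : nat) (M : set 'rV[R]_N) : Prop :=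
  forall p, M p -> exists (U : set 'rV[R]_m) (u : 'rV[R]_m -> 'rV[R]_N),
    local_param M U u /\ (u @` U) p.
Arguments submanifold {R} m {N} M.

Definition immersion (R : realType) (m K N : nat) (M : set 'rV[R]_K)
    (F : 'rV[R]_K -> 'rV[R]_N) : Prop :=
  forall (U : set 'rV[R]_m) (u : 'rV[R]_m -> 'rV[R]_K), local_param M U u ->
    smooth_on U (F \o u) /\
    forall y, U y -> row_free (tangent_mx (F \o u) y).
Arguments immersion {R} m {K N} M F.

(* C^n is identified with R^(n + n): z = x + i y is row_mx x y. *)
Definition Jmap (R : realType) n (z : 'rV[R]_(n + n)) : 'rV[R]_(n + n) :=
  row_mx (- rsubmx z) (lsubmx z).

Definition omega (R : realType) n (v w : 'rV[R]_(n + n)) : R :=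
  dot (Jmap v) w.

(* (rho_1 e^(i theta_1), ..., rho_n e^(i theta_n)), for real, possibly
   negative, rho_j. *)
Definition polar (R : realType) n (rho theta : 'I_n -> R) : 'rV[R]_(n + n) :=
  row_mx (\row_j (rho j * cos (theta j))) (\row_j (rho j * sin (theta j))).

(* L is the image of the n-dimensional manifold M under the immersion F, and
   the symplectic form vanishes on all tangent spaces. *)
Definition immersed_Lagrangian (R : realType) (n K : nat) (M : set 'rV[R]_K)
    (F : 'rV[R]_K -> 'rV[R]_(n + n)) (L : set 'rV[R]_(n + n)) : Prop :=
  [/\ submanifold n M, F @` M = L, immersion n M F
    & forall (U : set 'rV[R]_n) (u : 'rV[R]_n -> 'rV[R]_K),
        local_param M U u -> forall y, U y -> forall i j : 'I_n,
        omega (pd i (F \o u) y) (pd j (F \o u) y) = 0].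

(* Orthogonal projection to the normal space: kermx T^T is the orthogonal
   complement of the row space of T. *)
Definition normal_proj (R : realType) m N (f : 'rV[R]_m -> 'rV[R]_N)
    (y : 'rV[R]_m) (v : 'rV[R]_N) : 'rV[R]_N :=
  let T := tangent_mx f y in v *m proj_mx (kermx T^T) <<T>>%MS.

Lemma row_kermx_tr_eq0 (R : realType) m N (T : 'M[R]_(m, N)) (v : 'rV[R]_N) :
  (v <= T)%MS -> v *m T^T = 0 -> v = 0.
Proof.
move=> /submxP[c ->] h.
have : dot (c *m T) (c *m T) = 0 by rewrite /dot trmx_mul mulmxA h mul0mx mxE.
rewrite /dot mxE => h0; apply/rowP => j; rewrite [RHS]mxE.
have ge0 i : true -> 0 <= (c *m T) 0 i * (c *m T)^T i 0.
  by move=> _; rewrite [X in _ * X]mxE -expr2 sqr_ge0.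
have /eqP := psumr_eq0P ge0 h0 (isT : xpredT j).
by rewrite [X in _ * X]mxE -expr2 sqrf_eq0 => /eqP.
Qed.

Lemma normal_projP (R : realType) m N (f : 'rV[R]_m -> 'rV[R]_N)
    (y : 'rV[R]_m) (v : 'rV[R]_N) :
  (forall i, dot (normal_proj f y v) (pd i f y) = 0) /\
  (v - normal_proj f y v <= tangent_mx f y)%MS.
Proof.
rewrite /normal_proj; set T := tangent_mx f y; set K := kermx T^T.
have dx : (K :&: <<T>>)%MS = 0.
  apply/eqP; rewrite -submx0; apply/rV_subP => w; rewrite sub_capmx genmxE.
  move=> /andP[/sub_kermxP wK wT]; rewrite submx0.
  by apply/eqP; exact: (row_kermx_tr_eq0 wT wK).
have full : (v <= K + <<T>>)%MS.
  apply: submx_full; rewrite -col_leq_rank.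
  have := mxrank_sum_cap K <<T>>%MS.
  rewrite dx mxrank0 addn0 => ->.
  by rewrite mxrank_ker mxrank_gen mxrank_tr subnK // rank_leq_col.
split; last by rewrite -(genmxE T); exact: proj_mx_compl_sub.
have /sub_kermxP h := proj_mx_sub K <<T>>%MS v.
move=> i; have := congr1 (fun A : 'rV[R]_m => A 0 i) h.
rewrite /dot !mxE => {2}<-; apply: eq_bigr => j _.
by rewrite [T^T _ _]mxE !mxE.
Qed.

Definition first_fund (R : realType) m N (f : 'rV[R]_m -> 'rV[R]_N)
    (y : 'rV[R]_m) : 'M[R]_m := \matrix_(i, j) dot (pd i f y) (pd j f y).

Definition second_fund (R : realType) m N (f : 'rV[R]_m -> 'rV[R]_N)
    (y : 'rV[R]_m) (i j : 'I_m) : 'rV[R]_N :=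
  normal_proj f y (pd i (pd j f) y).

(* The trace sum_(i, j) g^(ij) A_(ij) of the second fundamental form (not
   divided by the dimension). *)
Definition mean_curvature (R : realType) m N (f : 'rV[R]_m -> 'rV[R]_N)
    (y : 'rV[R]_m) : 'rV[R]_N :=
  \sum_i \sum_j invmx (first_fund f y) i j *: second_fund f y i j.

(* The integral from a to b, with the usual sign when b < a. *)
Definition oriented_int (R : realType) (a b : R) (f : R -> R) : R :=
  if a <= b then \int[lebesgue_measure]_(t in `[a, b]) f t
  else - \int[lebesgue_measure]_(t in `[b, a]) f t.

(* Main.v *)
Require Import Defs.
From mathcomp Require Import all_boot all_order all_algebra.
From mathcomp Require Import all_classical all_reals all_analysis.
From mathcomp Require Import ring lra.
Import Order.TTheory GRing.Theory Num.Theory.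
Import numFieldNormedType.Exports.
Local Open Scope classical_set_scope.
Local Open Scope ring_scope.

Set Implicit Arguments.
Unset Strict Implicit.
Unset Printing Implicit Defensive.

(** Write [w_j = r_j e^(i phi_j) = P_j + i Q_j], [rho_j = 1 / r_j ^ 2] and
    [q = |B| / sqrt (G - 1)], where
    [G = E (prod_k (1 + 2 a_k B lam_k s)) e^(2 B alpha s)].  The formulas for
    [r_j] and [phi_j] give
      [conj w_j * w_j' = lam_j (B + i q)],
    with a right-hand side whose only dependence on [j] is the factor [lam_j].
    Moreover [rho_j' = - 2 lam_j B rho_j ^ 2] and
      [q' = - (B ^ 2 + q ^ 2) / B * q * (alpha + sum_j lam_j rho_j)].
    These identities ([profile], [profile_explicit]) are all that is needed of
    the data.  They are a polynomial differential system, so the curves are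
    smooth ([profile_Ck]).  The quadric times [I] is covered by graph charts
    over the coordinate hyperplanes ([quadric_submanifold]).

    In a chart [u = (x, S)] of the quadric times [I], let [v_i] and [sigma_i]
    be the partial derivatives of [x] and [S].  The map is
    [f_l = x_l w_l(S)], and the equation of the quadric gives
    [sum_l lam_l x_l v_il = 0].  Hence the Hermitian products of the partial
    derivatives of [f] are real, which is the Lagrangian condition
    ([jet_omega]), and the induced metric is
      [g_ij = sum_l v_il v_jl / rho_l + K sigma_i sigma_j],
    with [K = (B ^ 2 + q ^ 2) A] and [A = sum_l lam_l ^ 2 x_l ^ 2 rho_l].
    Since [q] is nonzero and [x] does not vanish, [f] is an immersion
    ([jet_row_free]).

    The vectors [J d_k f] span the normal space, so it suffices to compare
    the pairings of [C H] and of [alpha F^perp] with them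
    ([mean_curvature_eq]).  One finds [<F, J d_k f> = - q C sigma_k], and
    the cubic form [<d_i d_j f, J d_k f>] is
      [q (sigma_i V_jk + sigma_j V_ik + sigma_k V_ij)
       + sigma_i sigma_j sigma_k (B q' A + q (B ^ 2 + q ^ 2) A3)],
    with [V_ij = sum_l lam_l v_il v_jl] and
    [A3 = sum_l lam_l ^ 3 x_l ^ 2 rho_l ^ 2] ([jet_cubic_form]).  The
    contraction with the inverse metric is computed by completing the frame
    [(v, sigma)] with its normal [(lam x rho, 0)] for the weights
    [(1 / rho, K)] ([frame_completeness], [frame_contraction]): the terms in
    [A3] cancel and there remains
      [sigma_k (q sum_l lam_l rho_l + B q' / (B ^ 2 + q ^ 2))],
    which is [- alpha q sigma_k] by the equation for [q']
    ([jet_mean_curvature]). *)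

(** * Linear algebra of frames *)

Lemma gram_unit (R : realType) m N (T : 'M[R]_(m, N)) :
  row_free T -> T *m T^T \in unitmx.
Proof.
move=> fT; rewrite -row_free_unit; apply: inj_row_free => c.
rewrite mulmxA => h.
have := row_kermx_tr_eq0 (submxMl c T) h.
by rewrite -[X in _ = X](mul0mx _ T); exact: (row_free_inj fT).
Qed.

(** The inverse Gram matrix of a hyperplane frame [T] for the bilinear form
    [D], computed by completing [T] with a [D]-normal vector [N]: this is the
    resolution of the identity of the completed frame. *)
Lemma frame_completeness (R : realType) n (T : 'M[R]_(n, n + 1))
    (D D' : 'M[R]_(n + 1)) (N : 'rV[R]_(n + 1)) (c : R) :
  D *m D' = 1%:M -> T *m D *m T^T \in unitmx -> c != 0 ->
  T *m D *m N^T = 0 -> N *m D *m T^T = 0 -> N *m D *m N^T = c%:M ->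
  T^T *m invmx (T *m D *m T^T) *m T = D' - c^-1 *: (N^T *m N).
Proof.
move=> DD' ug c0 hTN hNT hNN; set g := T *m D *m T^T in ug *.
pose P := col_mx T N.
pose Bi : 'M[R]_(n + 1) := block_mx (invmx g) 0 0 (c^-1)%:M.
have PP : P *m (D *m P^T *m Bi) = 1%:M.
  rewrite !mulmxA /P /Bi tr_col_mx mul_col_mx mul_col_row -/g hTN hNT hNN.
  rewrite mulmx_block !mulmx0 !mul0mx !addr0 !add0r mulmxV // -scalar_mxM.
  by rewrite mulfV // -scalar_mx_block.
have := mulmx1C PP; rewrite -!mulmxA => /(congr1 (mulmx D')).
rewrite [LHS]mulmxA (mulmx1C DD') mul1mx mulmx1 => <-.
rewrite /P /Bi tr_col_mx mul_block_col !mul0mx addr0 add0r mul_row_col.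
by rewrite mul_scalar_mx -scalemxAr addrK mulmxA.
Qed.

(** A vector orthogonal to a Lagrangian plane and to its image under the
    complex structure vanishes. *)
Lemma Lagrangian_frame_total (R : realType) n (T : 'M[R]_(n, n + n))
    (z : 'rV[R]_(n + n)) :
  row_free T ->
  (forall i j, omega (row i T) (row j T) = 0) ->
  (forall i, dot z (row i T) = 0) ->
  (forall i, dot z (Jmap (row i T)) = 0) -> z = 0.
Proof.
move=> fT om z1 z2.
pose JT := \matrix_(i < n) Jmap (row i T).
have dotE m1 m2 (A : 'M[R]_(m1, n + n)) (A' : 'M[R]_(m2, n + n)) i j :
    (A *m A'^T) i j = dot (row i A) (row j A').
  by rewrite /dot !mxE; apply: eq_bigr => k _; rewrite !mxE.
have dotC (v w : 'rV[R]_(n + n)) : dot v w = dot w v.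
  by rewrite /dot !mxE; apply: eq_bigr => k _; rewrite !mxE mulrC.
have JJ (v w : 'rV[R]_(n + n)) : dot (Jmap v) (Jmap w) = dot v w.
  rewrite /dot -[in RHS](hsubmxK v) -[in RHS](hsubmxK w) /Jmap !tr_row_mx.
  by rewrite !mul_row_col linearN /= mulNmx mulmxN opprK addrC.
have TJ : T *m JT^T = 0.
  by apply/matrixP => i j; rewrite dotE rowK dotC mxE; exact: om.
have JTT : JT *m T^T = 0.
  by apply/matrixP => i j; rewrite dotE rowK mxE; exact: om.
have JTJT : JT *m JT^T = T *m T^T.
  by apply/matrixP => i j; rewrite !dotE !rowK JJ.
pose P := col_mx T JT.
have ug := gram_unit fT.
have uP : P \in unitmx.
  have : P *m P^T \in unitmx.
    rewrite /P tr_col_mx mul_col_row TJ JTT JTJT unitmxE det_ublock unitrM.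
    by rewrite -!unitmxE ug.
  by rewrite unitmx_mul => /andP[].
have : z *m P^T = 0.
  have zT : z *m T^T = 0 by apply/rowP => j; rewrite dotE row_id z1 mxE.
  have zJT : z *m JT^T = 0.
    by apply/rowP => j; rewrite dotE row_id rowK z2 mxE.
  by rewrite /P tr_col_mx mul_mx_row zT zJT row_mx0.
move/(congr1 (mulmx^~ (invmx P^T))); rewrite mulmxK ?mul0mx //.
by rewrite unitmx_tr.
Qed.

(** * Functions of class C^k *)

(** Real-valued functions all of whose iterated partial derivatives up to
    order [k] exist and are continuous on [U].  Smoothness of a vector-valued
    map amounts to this property for all [k] and all coordinates, see
    [smooth_onP]; scalar functions can moreover be multiplied. *)
Fixpoint Ck (R : realType) m (U : set 'rV[R]_m) (k : nat)
    (g : 'rV[R]_m -> R) : Prop :=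
  (forall y, U y -> {for y, continuous g}) /\
  if k is k'.+1 then
    (forall i y, U y -> derivable g y (delta_mx 0 i)) /\
    forall i, Ck U k' (fun y => 'D_(delta_mx 0 i) g y)
  else True.

Lemma Ck_continuous (R : realType) m (U : set 'rV[R]_m) k g :
  Ck U k g -> forall y, U y -> {for y, continuous g}.
Proof. by case: k => [|k] []. Qed.

Lemma eq_on_near (R : realType) m (U : set 'rV[R]_m) T (f g : 'rV[R]_m -> T) y :
  open U -> U y -> {in U, f =1 g} -> \forall z \near y, f z = g z.
Proof.
move=> oU Uy fg; near=> z; apply: fg; apply/mem_set; near: z.
exact: open_nbhs_nbhs.
Unshelve. all: by end_near. Qed.

Lemma eq_on_continuous (R : realType) m (U : set 'rV[R]_m) (f g : 'rV[R]_m -> R) :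
  open U -> {in U, f =1 g} -> (forall y, U y -> {for y, continuous f}) ->
  forall y, U y -> {for y, continuous g}.
Proof.
move=> oU fg cf y Uy; have := cf y Uy.
rewrite /prop_for /continuous_at -(fg y (mem_set Uy)) => cfy.
have fgn := eq_on_near oU Uy fg.
exact: (cvg_trans (near_eq_cvg (F := nbhs y) fgn) cfy).
Qed.

Lemma eq_Ck (R : realType) m (U : set 'rV[R]_m) k f g :
  open U -> {in U, f =1 g} -> Ck U k f -> Ck U k g.
Proof.
move=> oU; elim: k f g => [|k IH] f g fg /=.
  by move=> [cf _]; split=> //; exact: eq_on_continuous fg cf.
move=> [cf [df Df]]; split; [|split].
- exact: eq_on_continuous fg cf.
- move=> i y Uy; apply: near_eq_derivable (df i y Uy).
  exact: (eq_on_near oU Uy fg).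
- move=> i; apply: IH (Df i) => y /set_mem Uy; apply: near_eq_derive.
  exact: (eq_on_near oU Uy fg).
Qed.

Lemma CkW (R : realType) m (U : set 'rV[R]_m) k g : Ck U k.+1 g -> Ck U k g.
Proof.
elim: k g => [|k IH] g /= [cg]; first by [].
by move=> [dg Dg]; split=> //; split=> // i; exact: IH.
Qed.

Lemma Ck_cst (R : realType) m (U : set 'rV[R]_m) k (c : R) :
  Ck U k (fun=> c).
Proof.
elim: k c => [|k IH] c /=.
  by split=> // y _; exact: cst_continuous.
split; first by move=> y _; exact: cst_continuous.
split=> [i y _|i]; first exact: derivable_cst.
have -> : (fun y : 'rV[R]_m => 'D_(delta_mx 0 i) (fun=> c) y) = fun=> 0.
  by apply/funext => y; exact: derive_cst.
exact: IH.
Qed.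

Lemma CkD (R : realType) m (U : set 'rV[R]_m) k f g : open U ->
  Ck U k f -> Ck U k g -> Ck U k (fun y => f y + g y).
Proof.
move=> oU; elim: k f g => [|k IH] f g /=.
  move=> [cf _] [cg _]; split=> // y Uy.
  by apply: continuousD; [exact: cf | exact: cg].
move=> [cf [df Df]] [cg [dg Dg]]; split; [|split].
- by move=> y Uy; apply: continuousD; [exact: cf | exact: cg].
- by move=> i y Uy; apply: derivableD; [exact: df | exact: dg].
- move=> i; apply: eq_Ck oU _ (IH _ _ (Df i) (Dg i)) => y /set_mem Uy.
  by rewrite -deriveD //; [exact: df | exact: dg].
Qed.

Lemma CkM (R : realType) m (U : set 'rV[R]_m) k f g : open U ->
  Ck U k f -> Ck U k g -> Ck U k (fun y => f y * g y).
Proof.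
move=> oU; elim: k f g => [|k IH] f g.
  move=> [cf _] [cg _]; split=> // y Uy.
  by apply: continuousM; [exact: cf | exact: cg].
move=> Cf Cg; have Cf' := CkW Cf; have Cg' := CkW Cg.
move: Cf Cg => /= [cf [df Df]] [cg [dg Dg]]; split; [|split].
- by move=> y Uy; apply: continuousM; [exact: cf | exact: cg].
- by move=> i y Uy; apply: derivableM; [exact: df | exact: dg].
- move=> i.
  apply: eq_Ck oU _ (CkD oU (IH _ _ Cf' (Dg i)) (IH _ _ Cg' (Df i))).
  move=> y /set_mem Uy.
  by rewrite -[RHS]/('D_(delta_mx 0 i) (f * g) y) deriveM //;
    [exact: df | exact: dg].
Qed.

Lemma Ck_sum (R : realType) m (U : set 'rV[R]_m) k n
    (f : 'I_n -> 'rV[R]_m -> R) : open U ->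
  (forall j, Ck U k (f j)) -> Ck U k (fun y => \sum_j f j y).
Proof.
move=> oU; elim: n f => [|n IH] f Cf.
  rewrite (_ : (fun _ => _) = fun=> 0); first exact: Ck_cst.
  by apply/funext => y; rewrite big_ord0.
rewrite (_ : (fun _ => _) = fun y =>
  (\sum_(i < n) f (widen_ord (leqnSn n) i) y) + f ord_max y).
  by apply: CkD => //; apply: IH => j.
by apply/funext => y; rewrite big_ord_recr.
Qed.

(** A family of functions whose derivatives are of class C^k as soon as the
    family itself is of class C^k consists of smooth functions. *)
Lemma Ck_bootstrap (R : realType) m (U : set 'rV[R]_m) (J : Type)
    (f : J -> 'rV[R]_m -> R) :
  (forall j y, U y -> {for y, continuous (f j)}) ->
  (forall j i y, U y -> derivable (f j) y (delta_mx 0 i)) ->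
  (forall k, (forall j, Ck U k (f j)) ->
     forall j i, Ck U k (fun y => 'D_(delta_mx 0 i) (f j) y)) ->
  forall k j, Ck U k (f j).
Proof.
move=> cf df Df; elim=> [|k IH] j; first by split=> // y; exact: cf.
split; first by move=> y; exact: cf.
by split=> [i y|i]; [exact: df | exact: Df].
Qed.

Lemma mx_continuous_atP (R : realType) m N (f : 'rV[R]_m -> 'rV[R]_N) y :
  {for y, continuous f} <->
  forall l, {for y, continuous (fun z => f z 0 l)}.
Proof.
split=> [cf l|cf].
  exact: (continuous_comp cf (@coord_continuous R 1 N 0 l (f y))).
suff : f z @[z --> y] --> f y by [].
apply/(@cvgrPdist_lt _ _ _ (nbhs y) (nbhs_filter y)) => e e0; near=> z.
rewrite [ltLHS]mx_normrE (bigmax_lt _ e0) //= => -[i l] _ /=.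
rewrite ord1 !mxE; move: l; near: z; apply: filter_forall => l.
exact: ((@cvgrPdist_lt _ _ _ _ (nbhs_filter y) _ _).1 (cf l) e e0).
Unshelve. all: by end_near. Qed.

Lemma pd_coord (R : realType) m N (f : 'rV[R]_m -> 'rV[R]_N) i y l :
  derivable f y (delta_mx 0 i) ->
  pd i f y 0 l = 'D_(delta_mx 0 i) (fun z => f z 0 l) y.
Proof. by move=> df; rewrite /pd derive_mx // mxE. Qed.

Lemma derivable_coord (R : realType) m N (f : 'rV[R]_m -> 'rV[R]_N) v y l :
  derivable f y v -> derivable (fun z => f z 0 l) y v.
Proof. by move=> /derivable_mxP. Qed.

Lemma derivable_rV (R : realType) m N (f : 'rV[R]_m -> 'rV[R]_N) v y :
  (forall l, derivable (fun z => f z 0 l) y v) -> derivable f y v.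
Proof. by move=> df; apply/derivable_mxP => i l; rewrite ord1. Qed.

Lemma smooth_onP (R : realType) m N (U : set 'rV[R]_m)
    (f : 'rV[R]_m -> 'rV[R]_N) : open U ->
  smooth_on U f <-> forall k l, Ck U k (fun y => f y 0 l).
Proof.
move=> oU; split=> [sf k l|].
  elim: k f l sf => [|k IH] f l sf.
    split=> // y Uy; have [cf _] := sf [::] y Uy.
    by have /mx_continuous_atP := cf.
  split; [|split].
  - move=> y Uy; have [cf _] := sf [::] y Uy.
    by have /mx_continuous_atP := cf.
  - move=> i y Uy; have [_ df] := sf [::] y Uy.
    exact: derivable_coord.
  - move=> i; have H := IH (pd i f) l.
    apply: (eq_Ck oU _ (H _)) => [y /set_mem Uy|].
      by rewrite pd_coord //; have [_ ] := sf [::] y Uy.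
    by move=> s y Uy; have := sf (rcons s i) y Uy; rewrite foldr_rcons.
move=> Cf s; elim/last_ind: s f Cf => [|s i IH] f Cf y Uy.
  split; first by apply/mx_continuous_atP => l; exact: (Ck_continuous (Cf 0%N l)).
  by move=> i; apply: derivable_rV => l; case: (Cf 1%N l) => _ [df _]; exact: df.
rewrite foldr_rcons; apply: IH => // k l.
have [_ [_ Df]] := Cf k.+1 l.
apply: eq_Ck oU _ (Df i) => z /set_mem Uz; rewrite pd_coord //.
by apply: derivable_rV => l'; case: (Cf 1%N l') => _ [df _]; exact: df.
Qed.

(** Chain rule for a directional derivative; only the partial function
    [t |-> S (t v + y)] is differentiated, so that no total differentiability
    of [S] is needed. *)
Lemma is_derive_comp1 (R : realType) m (h : R -> R) (S : 'rV[R]_m -> R)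
    (y v : 'rV[R]_m) (d : R) :
  is_derive (S y) 1 h d -> derivable S y v ->
  is_derive y v (h \o S) (d * 'D_v S y).
Proof.
move=> [dh hd] dS.
have S0 : S (0 *: v + y) = S y by rewrite scale0r add0r.
pose g (t : R) : R := S (t *: v + y).
have dg : derivable g 0 1 by exact: (derivable1P S y v).1.
have dhg : derivable h (g 0) 1 by rewrite /g S0.
have Dlim (k : 'rV[R]_m -> R) : 'D_v k y = 'D_1 (fun t : R => k (t *: v + y)) 0.
  rewrite /derive; set g1 := fun h => h^-1 *: _; set g2 := fun h => h^-1 *: _.
  suff -> : g1 = g2 by [].
  by rewrite funeqE /g1 /g2 => t /=; rewrite addr0 scale0r add0r [_%:A]mulr1.
apply: DeriveDef.
  apply/derivable1P/derivable1_diffP.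
  by apply: (@differentiable_comp _ _ _ _ g h); apply/derivable1_diffP.
rewrite !Dlim -!derive1E (derive1_comp (f := g)) //.
by rewrite derive1E /g S0 hd.
Qed.

(** * The fundamental theorem of calculus for oriented integrals *)

Lemma integrable_segment (R : realType) (I : set R) (f : R -> R) (a b : R) :
  connected I -> (forall t, I t -> {for t, continuous f}) -> I a -> I b ->
  lebesgue_measure.-integrable `[a, b] (EFin \o f).
Proof.
move=> /connected_intervalP itvI cf Ia Ib.
apply: continuous_compact_integrable; first exact: segment_compact.
apply: continuous_in_subspaceT => t /set_mem /=; rewrite in_itv /= => abt.
by apply: cf; exact: (itvI a b).
Qed.

Lemma Rintegral_segmentB (R : realType) (f : R -> R) (a b c : R) :
  lebesgue_measure.-integrable `[a, c] (EFin \o f) -> a <= b -> b <= c ->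
  \int[lebesgue_measure]_(t in `[b, c]) f t =
  \int[lebesgue_measure]_(t in `[a, c]) f t -
  \int[lebesgue_measure]_(t in `[a, b]) f t.
Proof.
move=> fi ab bc; rewrite (Rintegral_itvB (x := b) fi) ?bnd_simp //.
rewrite Rintegral_itv_obnd_cbnd //.
by apply: integrableS fi => //; apply: subset_itvr; rewrite bnd_simp.
Qed.

(** The integral is anchored anew at a point [c] of [I] to the left of both
    [0] and [s], which covers all signs of [s] at once. *)
Lemma is_derive_oriented_int (R : realType) (I : set R) (f : R -> R) (s : R) :
  open I -> connected I -> I 0 ->
  (forall t, I t -> {for t, continuous f}) -> I s ->
  is_derive s 1 (fun u => oriented_int 0 u f) (f s).
Proof.
move=> oI cI I0 cf Is.
have itvI : is_interval I by exact/connected_intervalP.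
have nb x : I x -> exists e : R, [/\ 0 < e, I (x - e) & I (x + e)].
  move=> Ix; have /nbhs_ballP[e /= e0 eI] : nbhs x I by exact: open_nbhs_nbhs.
  exists (e / 2); split; first exact: divr_gt0.
    apply: eI; rewrite /ball /= opprB addrC subrK.
    by rewrite gtr0_norm ?divr_gt0 // ltr_pdivrMr // ltr_pMr // ltr1n.
  apply: eI; rewrite /ball /= opprD addrA subrr sub0r normrN.
  by rewrite gtr0_norm ?divr_gt0 // ltr_pdivrMr // ltr_pMr // ltr1n.
have [c [Ic c0 cs]] : exists c, [/\ I c, c < 0 & c < s].
  have [e0 [e00 Im0 _]] := nb _ I0; have [es [es0 Ims _]] := nb _ Is.
  have [s0|s0] := leP 0 s.
    by exists (0 - e0); split=> //; lra.
  by exists (s - es); split=> //; lra.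
have [d [Id sd]] : exists d, I d /\ s < d.
  by have [es [es0 _ Ims]] := nb _ Is; exists (s + es); split=> //; lra.
have intf a b : I a -> I b ->
    lebesgue_measure.-integrable `[a, b] (EFin \o f).
  exact: integrable_segment.
have E u : c < u -> u < d -> \int[lebesgue_measure]_(t in `[c, u]) f t -
    \int[lebesgue_measure]_(t in `[c, 0]) f t = oriented_int 0 u f.
  move=> cu ud; have Iu : I u by apply: (itvI c d) => //; rewrite !ltW.
  rewrite /oriented_int; case: leP => u0.
    by rewrite [RHS](@Rintegral_segmentB _ _ c) //; [exact: intf | exact: ltW].
  rewrite [in RHS](@Rintegral_segmentB _ _ c) ?opprB //; last 2 first.
  - exact: ltW.
  - exact: ltW.
  - exact: intf.
have [df fE] := continuous_FTC1_closed sd (intf _ _ Ic Id) cs (cf _ Is).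
have der : is_derive s 1 (fun u : R =>
    \int[lebesgue_measure]_(t in `[c, u]) f t -
    \int[lebesgue_measure]_(t in `[c, 0]) f t) (f s).
  rewrite -[f s]subr0; apply: (@is_deriveB _ _ _ _ (cst _)).
  by apply: DeriveDef => //; rewrite -derive1E.
apply: near_eq_is_derive der; near=> u; apply: E; near: u.
  exact: lt_nbhsr.
exact: lt_nbhsl.
Unshelve. all: by end_near. Qed.

(** * The profile curves *)

(** The curves [w_j = P j + i Q j] with [conj w_j * w_j' = lam j (B + i q)],
    together with [rho j = 1 / |w_j| ^ 2] and the differential equations of
    [rho] and [q].  The equation of [q] is the only one in which [alpha]
    occurs. *)
Record profile (R : realType) (n : nat) (B alpha : R) (lam : 'I_n -> R)
    (I : set R) (P Q rho : 'I_n -> R -> R) (q : R -> R) : Prop := Profile {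
  profile_P : forall j s, I s ->
    is_derive s 1 (P j) (lam j * rho j s * (B * P j s - q s * Q j s));
  profile_Q : forall j s, I s ->
    is_derive s 1 (Q j) (lam j * rho j s * (q s * P j s + B * Q j s));
  profile_rho : forall j s, I s ->
    is_derive s 1 (rho j) (- 2 * lam j * B * rho j s ^+ 2);
  profile_q : forall s, I s ->
    is_derive s 1 q (- (B ^+ 2 + q s ^+ 2) / B * q s *
                     (alpha + \sum_j lam j * rho j s));
  profile_norm : forall j s, I s -> rho j s * (P j s ^+ 2 + Q j s ^+ 2) = 1;
  profile_rho_gt0 : forall j s, I s -> 0 < rho j s;
  profile_q_gt0 : forall s, I s -> 0 < q s }.

Lemma is_derive_eqf (R : realType) (V : normedModType R) (f g : V -> R)
    (y v : V) (d d' : R) :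
  f =1 g -> d = d' -> is_derive y v f d -> is_derive y v g d'.
Proof. by move=> /funext -> ->. Qed.

Lemma is_derive_const (R : realType) (V : normedModType R) (c : R) (y v : V) :
  is_derive y v (fun=> c) (0 : R).
Proof. exact: is_derive_cst. Qed.

Lemma is_derive_mul (R : realType) (V : normedModType R) (f g : V -> R)
    (y v : V) (df dg : R) :
  is_derive y v f df -> is_derive y v g dg ->
  is_derive y v (fun u => f u * g u) (df * g y + f y * dg).
Proof.
move=> hf hg; apply: (is_derive_eqf _ _ (is_deriveM hf hg)) => //.
by rewrite /GRing.scale /=; ring.
Qed.

Lemma is_derive_inv (R : realType) (f : R -> R) (s df : R) :
  is_derive s 1 f df -> f s != 0 ->
  is_derive s 1 (fun u => (f u)^-1) (- df / f s ^+ 2).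
Proof.
move=> hf f0; apply: (is_derive_eqf _ _ (is_deriveV f0 hf)) => //.
by rewrite /GRing.scale /= mulNr mulrC mulNr.
Qed.

Lemma is_derive_sqrt (R : realType) (f : R -> R) (s df : R) :
  is_derive s 1 f df -> 0 < f s ->
  is_derive s 1 (fun u => Num.sqrt (f u)) ((2 * Num.sqrt (f s))^-1 * df).
Proof.
move=> hf f0; apply: (@is_derive1_comp _ Num.sqrt f) => //.
exact: is_derive1_sqrt.
Qed.

Lemma is_derive_affine (R : realType) (s b c : R) :
  is_derive s 1 (fun u : R => b + c * u) c.
Proof.
have h := is_deriveD (is_derive_cst b s 1) (is_deriveZ c (is_derive_id s 1)).
apply: (is_derive_eqf _ _ h) => //.
by rewrite add0r /GRing.scale /= mulr1.
Qed.

(** A product of functions with logarithmic derivatives [c j]. *)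
Lemma is_derive_prod (R : realType) n (h : 'I_n -> R -> R) (c : 'I_n -> R)
    (s : R) :
  (forall j, is_derive s 1 (h j) (h j s * c j)) ->
  is_derive s 1 (fun u => \prod_j h j u) ((\prod_j h j s) * \sum_j c j).
Proof.
elim: n h c => [|n IH] h c dh.
  apply: (is_derive_eqf _ _ (is_derive_const 1 s 1)).
    by move=> u; rewrite big_ord0.
  by rewrite !big_ord0 mulr0.
have h1 := IH _ _ (fun j => dh (widen_ord (leqnSn n) j)).
apply: (is_derive_eqf _ _ (is_derive_mul h1 (dh ord_max))).
  by move=> u; rewrite big_ord_recr.
by rewrite !big_ord_recr /=; ring.
Qed.

Lemma is_derive_continuous (R : realType) (f : R -> R) (s d : R) :
  is_derive s 1 f d -> {for s, continuous f}.
Proof.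
by move=> [df _]; apply: differentiable_continuous; exact/derivable1_diffP.
Qed.

Lemma profile_explicit (R : realType) (n : nat)
    (B E alpha : R) (lam a psi : 'I_n -> R) (I : set R)
    (hB : B != 0) (ha : forall j, 0 < a j)
    (hIopen : open I) (hIconn : connected I) (hI0 : I 0)
    (hpos : forall s, I s ->
      0 < E * (\prod_k (1 + 2 * a k * B * lam k * s))
            * expR (2 * B * alpha * s) - 1)
    (hrad : forall j s, I s -> 0 < 1 / a j + 2 * lam j * B * s) :
  let r (j : 'I_n) (s : R) : R := Num.sqrt (1 / a j + 2 * lam j * B * s) in
  let phi (j : 'I_n) (s : R) : R :=
    psi j + oriented_int 0 s (fun t : R =>
      lam j * `|B| /
        ((1 / a j + 2 * lam j * B * t) *
         Num.sqrt (E * (\prod_k (1 + 2 * a k * B * lam k * t))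
                     * expR (2 * B * alpha * t) - 1))) in
  profile B alpha lam I
    (fun j s => r j s * cos (phi j s)) (fun j s => r j s * sin (phi j s))
    (fun j s => (1 / a j + 2 * lam j * B * s)^-1)
    (fun s => `|B| / Num.sqrt (E * (\prod_k (1 + 2 * a k * B * lam k * s))
                                 * expR (2 * B * alpha * s) - 1)).
Proof.
move=> r phi.
set rho := fun (j : 'I_n) (s : R) => (1 / a j + 2 * lam j * B * s)^-1.
set G := fun s : R => E * (\prod_k (1 + 2 * a k * B * lam k * s))
                    * expR (2 * B * alpha * s).
set q := fun s : R => `|B| / Num.sqrt _.
have G1 s : I s -> 0 < G s - 1 by exact: hpos.
have rho0 j s : I s -> 0 < rho j s by move=> Is; rewrite invr_gt0 hrad.
have q0 s : I s -> 0 < q s.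
  by move=> Is; rewrite divr_gt0 ?normr_gt0 // sqrtr_gt0; exact: G1.
have dR j (s : R) : is_derive s 1 (fun u : R => 1 / a j + 2 * lam j * B * u : R)
    (2 * lam j * B) by exact: is_derive_affine.
have drho j (s : R) : I s ->
    is_derive s 1 (rho j) (- 2 * lam j * B * rho j s ^+ 2).
  move=> Is; have R0 := lt0r_neq0 (hrad j s Is).
  apply: (is_derive_eqf _ _ (is_derive_inv (dR j s) R0)) => //.
  by rewrite /rho exprVn; ring.
have dG (s : R) : I s -> is_derive s 1 G
    (2 * B * G s * (alpha + \sum_j lam j * rho j s)).
  move=> Is.
  have dl j : is_derive s 1 (fun u : R => 1 + 2 * a j * B * lam j * u)
      ((1 + 2 * a j * B * lam j * s) * (2 * B * (lam j * rho j s))).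
    apply: is_derive_eq (is_derive_affine _ _ _) _.
    rewrite /rho; have /lt0r_neq0 := hrad j s Is; have := lt0r_neq0 (ha j).
    move=> a0; have -> : 1 + 2 * a j * B * lam j * s =
        a j * (1 / a j + 2 * lam j * B * s) by field.
    by set X := _ + _ => X0; field.
  have de : is_derive s 1 (fun u : R => expR (2 * B * alpha * u))
      (expR (2 * B * alpha * s) * (2 * B * alpha)).
    have := is_derive_affine s 0 (2 * B * alpha).
    rewrite (_ : (fun _ => _) = fun u => 2 * B * alpha * u); last first.
      by apply/funext => u; rewrite add0r.
    by move=> h; exact: (is_derive1_comp (is_derive_expR _) h).
  have dp := is_derive_prod dl.
  have dEp := is_derive_mul (is_derive_const E s 1) dp.
  apply: (is_derive_eqf _ _ (is_derive_mul dEp de)) => //.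
  by rewrite -mulr_sumr /G /cst; ring.
have dS (s : R) : I s -> is_derive s 1 (fun u : R => Num.sqrt (G u - 1))
    ((2 * Num.sqrt (G s - 1))^-1 *
     (2 * B * G s * (alpha + \sum_j lam j * rho j s))).
  move=> Is; have h := is_deriveB (dG s Is) (is_derive_const 1 s 1).
  by apply: (is_derive_eqf _ _ (is_derive_sqrt h (G1 s Is))); rewrite ?subr0.
have dq (s : R) : I s -> is_derive s 1 q (- (B ^+ 2 + q s ^+ 2) / B * q s *
                     (alpha + \sum_j lam j * rho j s)).
  move=> Is; have S0 : Num.sqrt (G s - 1) != 0.
    by apply: lt0r_neq0; rewrite sqrtr_gt0; exact: G1.
  have h := is_derive_mul (is_derive_const `|B| s 1) (is_derive_inv (dS s Is) S0).
  apply: (is_derive_eqf _ _ h) => //.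
  rewrite /q mul0r add0r.
  (* B ^ 2 + q ^ 2 = B ^ 2 G / (G - 1) *)
  have GE : G s = Num.sqrt (G s - 1) ^+ 2 + 1.
    by rewrite sqr_sqrtr ?subrK // ltW // G1.
  rewrite -/(G s) {2}GE expr_div_n real_normK ?num_real //.
  move: S0; set S := Num.sqrt (G s - 1) => S0.
  field; exact/andP.
have qE s : q s = `|B| / Num.sqrt (G s - 1) by [].
have dphi j (s : R) : I s -> is_derive s 1 (phi j) (lam j * rho j s * q s).
  move=> Is; pose f t := lam j * rho j t * q t.
  have cf t : I t -> {for t, continuous f}.
    move=> It.
    have dl := is_derive_mul (is_derive_const (lam j) t 1) (drho j t It).
    exact: is_derive_continuous (is_derive_mul dl (dq t It)).
  have := is_derive_oriented_int hIopen hIconn hI0 cf Is.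
  move/(is_deriveD (is_derive_const (psi j) s 1)).
  apply: is_derive_eqf; last by rewrite add0r.
  move=> u; rewrite /phi /=; congr (_ + oriented_int _ _ _).
  apply/funext => t; rewrite /f /rho /q invfM; ring.
have r0 j s : I s -> r j s != 0.
  by move=> Is; rewrite lt0r_neq0 // sqrtr_gt0 hrad.
have rE j s : I s -> rho j s = (r j s ^+ 2)^-1.
  by move=> Is; rewrite /r sqr_sqrtr // ltW // hrad.
have dr j (s : R) : I s -> is_derive s 1 (r j) (lam j * B * rho j s * r j s).
  move=> Is.
  apply: (is_derive_eqf _ _ (is_derive_sqrt (dR j s) (hrad j s Is))) => //.
  rewrite rE //; have := r0 j s Is; rewrite /r => S0.
  by field.
split=> //.
- move=> j s Is; have dc := is_derive1_comp (is_derive_cos _) (dphi j s Is).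
  apply: (is_derive_eqf _ _ (is_derive_mul (dr j s Is) dc)) => //=.
  ring.
- move=> j s Is; have dc := is_derive1_comp (is_derive_sin _) (dphi j s Is).
  apply: (is_derive_eqf _ _ (is_derive_mul (dr j s Is) dc)) => //=.
  ring.
- move=> j s Is; rewrite !exprMn -mulrDr cos2Dsin2 mulr1 rE //.
  by rewrite mulVf // expf_neq0 // r0.
Qed.

(** * The product of the quadric with an open set of parameters *)

(** Composition of a smooth function [S] with a family of functions of one
    variable whose derivatives are obtained from the family by operations
    preserving C^k. *)
Lemma Ck_comp_family (R : realType) m (U : set 'rV[R]_m) (I : set R)
    (J : Type) (h dh : J -> R -> R) (S : 'rV[R]_m -> R) : open U ->
  (forall k, Ck U k S) -> (forall y, U y -> I (S y)) ->
  (forall j s, I s -> is_derive s 1 (h j) (dh j s)) ->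
  (forall k, (forall j, Ck U k (h j \o S)) -> forall j, Ck U k (dh j \o S)) ->
  forall k j, Ck U k (h j \o S).
Proof.
move=> oU CS SI der closed.
have dS i y : U y -> derivable S y (delta_mx 0 i).
  by move=> Uy; have [_ [dS _]] := CS 1%N; exact: dS.
have D j i y : U y -> is_derive y (delta_mx 0 i) (h j \o S)
    (dh j (S y) * 'D_(delta_mx 0 i) S y).
  by move=> Uy; apply: is_derive_comp1; [apply: der; exact: SI | exact: dS].
apply: Ck_bootstrap => [j y Uy|j i y Uy|k Ch j i].
- apply: continuous_comp; first exact: (Ck_continuous (CS 0%N)).
  exact: (is_derive_continuous (der j _ (SI y Uy))).
- by have [] := D j i y Uy.
- have [_ [_ DS]] := CS k.+1.
  apply: eq_Ck oU _ (CkM oU (closed k Ch j) (DS i)) => y /set_mem Uy.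
  by have [_ ->] := D j i y Uy.
Qed.

Lemma derive_coord (R : realType) m (k : 'I_m) (y v : 'rV[R]_m) :
  is_derive y v (fun z : 'rV[R]_m => z 0 k) (v 0 k).
Proof.
have did : derivable (@id 'rV[R]_m) y v by exact: derivable_id.
apply: DeriveDef; first exact: derivable_coord did.
have := derive_mx did.
by move/rowP/(_ k); rewrite derive_id mxE => ->.
Qed.

Lemma Ck_coord (R : realType) m (U : set 'rV[R]_m) (i : 'I_m) k :
  Ck U k (fun y => y 0 i).
Proof.
case: k => [|k]; first by split=> // y _; exact: (@coord_continuous R 1).
split; first by move=> y _; exact: (@coord_continuous R 1).
split=> [j y _|j]; first by have [] := derive_coord i y (delta_mx 0 j).
have -> : (fun y : 'rV[R]_m => 'D_(delta_mx 0 j) (fun z : 'rV[R]_m => z 0 i) y) =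
    fun=> (delta_mx 0 j : 'rV[R]_m) 0 i.
  by apply/funext => y; have [_] := derive_coord i y (delta_mx 0 j).
exact: Ck_cst.
Qed.

Lemma Ck_sqrt (R : realType) m (U : set 'rV[R]_m) (h : 'rV[R]_m -> R) k :
  open U -> (forall k', Ck U k' h) -> (forall y, U y -> 0 < h y) ->
  Ck U k (fun y => Num.sqrt (h y)).
Proof.
move=> oU Ch h0.
pose f (b : bool) (t : R) : R := if b then Num.sqrt t else (Num.sqrt t)^-1.
pose df (b : bool) (t : R) : R :=
  if b then 2^-1 * f false t
  else - 2^-1 * (f false t * (f false t * f false t)).
apply: (@Ck_comp_family _ _ U [set t | 0 < t] _ f df h oU Ch h0 _ _ k true).
  move=> b t /= t0.
  have t1 : Num.sqrt t != 0 by rewrite lt0r_neq0 // sqrtr_gt0.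
  have ds := is_derive_sqrt (is_derive_id t 1) t0.
  case: b; rewrite /df /f.
    by apply: (is_derive_eqf _ _ ds) => //; rewrite invfM mulr1.
  by apply: (is_derive_eqf _ _ (is_derive_inv ds t1)) => //; field.
move=> {}k Cf b; have Cf0 := Cf false; case: b; rewrite /df /=.
  exact: (CkM oU (Ck_cst _ _ _) Cf0).
exact: (CkM oU (Ck_cst _ _ _) (CkM oU Cf0 (CkM oU Cf0 Cf0))).
Qed.

Lemma quadric_submanifold (R : realType) n (C : R) (lam : 'I_n -> R)
    (I : set R) : C != 0 -> (forall j, lam j != 0) -> open I ->
  submanifold n [set p : 'rV[R]_(n + 1) |
    \sum_j lam j * lsubmx p 0 j ^+ 2 = C /\ I (rsubmx p 0 0)].
Proof.
move=> C0 lam0 oI p [pC Ip].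
have [j0 x0] : exists j0, lsubmx p 0 j0 != 0.
  apply: contrapT => /forallNP x0; move: C0; rewrite -pC big1 ?eqxx // => j _.
  by have /negP := x0 j; rewrite negbK => /eqP ->; rewrite expr0n mulr0.
pose eps : R := Num.sg (lsubmx p 0 j0).
have epsE : eps * eps = 1 by rewrite -expr2 sqr_sg x0.
(* The square of the eliminated coordinate as a function of the others. *)
pose h (y : 'rV[R]_n) : R :=
  (lam j0)^-1 * (C + \sum_k (k != j0)%:R * (- lam k * (y 0 k * y 0 k))).
(* The graph chart: the parameter s takes the place of the eliminated
   coordinate. *)
pose u (y : 'rV[R]_n) : 'rV[R]_(n + 1) :=
  row_mx (\row_k if k == j0 then eps * Num.sqrt (h y) else y 0 k)
         (y 0 j0)%:M.
pose sel (q : 'rV[R]_(n + 1)) : 'rV[R]_n :=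
  \row_k if k == j0 then q 0 (rshift n 0) else q 0 (lshift 1 k).
pose U := [set y | 0 < h y /\ I (y 0 j0)].
have hE (q : 'rV[R]_(n + 1)) : \sum_j lam j * lsubmx q 0 j ^+ 2 = C ->
    h (sel q) = lsubmx q 0 j0 ^+ 2.
  move=> qC; rewrite /h -qC [X in X + _](bigD1 j0) //=.
  rewrite [X in _ + X](_ : _ =
      - \sum_(i < n | i != j0) lam i * lsubmx q 0 i ^+ 2).
    by rewrite addrK mulKf.
  rewrite [LHS](bigD1 j0) //= eqxx mul0r add0r -sumrN.
  apply: eq_bigr => k kj; rewrite kj mul1r !mxE (negbTE kj) expr2.
  by rewrite mulNr.
have uM y : U y -> \sum_j lam j * lsubmx (u y) 0 j ^+ 2 = C.
  move=> [h0 _]; rewrite (bigD1 j0) //= /u row_mxKl mxE eqxx exprMn.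
  rewrite [eps ^+ 2]expr2 epsE mul1r sqr_sqrtr ?ltW // /h mulVKf //.
  rewrite (bigD1 j0) //= eqxx mul0r add0r -addrA -big_split /= big1 ?addr0 //.
  by move=> k kj; rewrite kj mul1r mxE (negbTE kj); ring.
have usel y : sel (u y) = y.
  apply/rowP => k; rewrite /sel /u mxE; case: eqP => [->|/eqP kj].
    by rewrite row_mxEr mxE eqxx mulr1n.
  by rewrite row_mxEl mxE (negbTE kj).
have Ch V k : open V -> Ck V k h.
  move=> oV; apply: (CkM oV (Ck_cst _ _ _)); apply: (CkD oV (Ck_cst _ _ _)).
  apply: (Ck_sum oV) => l; apply: (CkM oV (Ck_cst _ _ _)).
  by apply: (CkM oV (Ck_cst _ _ _)); apply: (CkM oV); exact: Ck_coord.
have oU : open U.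
  rewrite (_ : U = h @^-1` [set t | 0 < t] `&` (fun y => y 0 j0) @^-1` I) //.
  apply: openI; apply: open_comp => //.
  - by move=> y _; exact: (Ck_continuous (Ch setT 0%N openT)).
  - by move=> y _; exact: (@coord_continuous R 1).
have Cu k l : Ck U k (fun y => u y 0 l).
  case: (split_ordP l) => [k' ->|k' ->].
    have -> : (fun y => u y 0 (lshift 1 k')) =
        fun y => if k' == j0 then eps * Num.sqrt (h y) else y 0 k'.
      by apply/funext => y; rewrite /u row_mxEl mxE.
    case: (k' == j0); last exact: Ck_coord.
    apply: (CkM oU (Ck_cst _ _ _)); apply: (Ck_sqrt _ oU) => [k''|y []//].
    exact: Ch.
  have -> : (fun y => u y 0 (rshift n k')) = fun y => y 0 j0.
    by apply/funext => y; rewrite /u row_mxEr mxE ord1 eqxx mulr1n.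
  exact: Ck_coord.
have du i y l : U y ->
    pd i u y 0 l = 'D_(delta_mx 0 i) (fun z => u z 0 l) y.
  move=> Uy; apply: pd_coord; apply: derivable_rV => l'.
  by have [_ [du _]] := Cu 1%N l'; exact: du.
exists U, u; split.
  split=> //.
  - exact/(smooth_onP _ oU).
  - move=> y Uy; apply: inj_row_free => c cT; apply/rowP => k; rewrite mxE.
    pose l : 'I_(n + 1) := if k == j0 then rshift n 0 else lshift 1 k.
    have lE : (fun z => u z 0 l) = fun z => z 0 k.
      apply/funext => z; rewrite /l; case: eqP => [->|/eqP kj].
        by rewrite /u row_mxEr mxE eqxx mulr1n.
      by rewrite /u row_mxEl mxE (negbTE kj).
    have := congr1 (fun A : 'rV[R]_(n + 1) => A 0 l) cT; rewrite !mxE => <-.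
    rewrite (bigD1 k) //= big1 ?addr0 => [|i ik].
      rewrite mxE du // lE; have [_ ->] := derive_coord k y (delta_mx 0 k).
      by rewrite mxE !eqxx mulr1.
    rewrite mxE du // lE; have [_ ->] := derive_coord k y (delta_mx 0 i).
    by rewrite mxE eq_sym (negbTE ik) andbF mulr0.
  - by move=> y z _ _ uyz; rewrite -(usel y) uyz usel.
  - move=> V oV VU.
    (* The sign condition selects the sheet of the quadric over V. *)
    exists (sel @^-1` V `&`
            (fun q => eps * q 0 (lshift 1 j0)) @^-1` [set t | 0 < t]).
    split.
      apply: openI; apply: open_comp => //.
        move=> q _; apply/mx_continuous_atP => k.
        have -> : (fun z => sel z 0 k) = fun z : 'rV[R]_(n + 1) =>
            z 0 (if k == j0 then rshift n 0 else lshift 1 k).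
          by apply/funext => z; rewrite /sel mxE; case: ifP.
        exact: (@coord_continuous R 1).
      move=> q _; apply: (@Ck_continuous _ _ setT 0 _ _ q Logic.I).
      by apply: (CkM openT (Ck_cst _ _ _)); exact: Ck_coord.
    apply/seteqP; split=> [_ [y Vy <-]|q [[qC Iq] [Vq eq0]]].
      have Uy := VU y Vy; split; [split|split].
      - exact: uM.
      - by rewrite /u row_mxKr mxE eqxx mulr1n; case: Uy.
      - by rewrite /= usel.
      - rewrite /= /u row_mxEl mxE eqxx mulrA epsE mul1r sqrtr_gt0.
        by case: Uy.
    exists (sel q) => //; apply/rowP => l; rewrite /u.
    case: (split_ordP l) => [k ->|k ->].
      rewrite row_mxEl mxE; case: eqP => [->|/eqP kj]; last first.
        by rewrite /sel mxE (negbTE kj).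
      rewrite hE // sqrtr_sqr mxE; move: eq0 => /=.
      set x := q _ _ => ex; rewrite -[x in RHS]mul1r -epsE -mulrA.
      have -> : `|x| = `|eps * x|.
        by rewrite normrM /eps normr_sg x0 mul1r.
      by rewrite gtr0_norm.
    by rewrite row_mxEr mxE ord1 /sel mxE !eqxx mulr1n.
exists (sel p); first split.
- by rewrite hE // exprn_even_gt0.
- by move: Ip; rewrite /= /sel !mxE eqxx.
- apply/rowP => l; rewrite /u; case: (split_ordP l) => [k ->|k ->].
    rewrite row_mxEl mxE; case: eqP => [->|/eqP kj]; last first.
      by rewrite /sel mxE (negbTE kj).
    by rewrite hE // sqrtr_sqr -numEsg mxE.
  by rewrite row_mxEr mxE ord1 /sel mxE !eqxx mulr1n.
Qed.

(** * Normal vectors of a Lagrangian immersion *)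

Lemma dotE (R : realType) n (w z : 'rV[R]_(n + n)) :
  dot w z = \sum_l (w 0 (lshift n l) * z 0 (lshift n l) +
                    w 0 (rshift n l) * z 0 (rshift n l)).
Proof.
rewrite /dot mxE big_split_ord /= -big_split /=.
by apply: eq_bigr => l _; rewrite !mxE.
Qed.

Lemma dotC (R : realType) N (w z : 'rV[R]_N) : dot w z = dot z w.
Proof. by rewrite /dot !mxE; apply: eq_bigr => l _; rewrite !mxE mulrC. Qed.

Lemma dotDl (R : realType) N (w w' z : 'rV[R]_N) :
  dot (w + w') z = dot w z + dot w' z.
Proof. by rewrite /dot mulmxDl mxE. Qed.

Lemma dotZl (R : realType) N c (w z : 'rV[R]_N) : dot (c *: w) z = c * dot w z.
Proof. by rewrite /dot -scalemxAl mxE. Qed.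

Lemma dot_suml (R : realType) N m (w : 'I_m -> 'rV[R]_N) (z : 'rV[R]_N) :
  dot (\sum_i w i) z = \sum_i dot (w i) z.
Proof. by rewrite /dot mulmx_suml summxE. Qed.

Lemma Jmap_l (R : realType) n (w : 'rV[R]_(n + n)) l :
  Jmap w 0 (lshift n l) = - w 0 (rshift n l).
Proof. by rewrite /Jmap row_mxEl !mxE. Qed.

Lemma Jmap_r (R : realType) n (w : 'rV[R]_(n + n)) l :
  Jmap w 0 (rshift n l) = w 0 (lshift n l).
Proof. by rewrite /Jmap row_mxEr !mxE. Qed.

(** The normal projection does not change the pairing with [J] of a tangent
    vector of a Lagrangian immersion. *)
Lemma dot_normal_proj_J (R : realType) n (f : 'rV[R]_n -> 'rV[R]_(n + n)) y
    (w : 'rV[R]_(n + n)) k :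
  (forall i j, omega (pd i f y) (pd j f y) = 0) ->
  dot (normal_proj f y w) (Jmap (pd k f y)) = dot w (Jmap (pd k f y)).
Proof.
move=> om; have [_ /submxP[c hc]] := normal_projP f y w.
rewrite -[in RHS](subrK (normal_proj f y w) w) hc dotDl mulmx_sum_row dot_suml.
rewrite big1 ?add0r // => i _; rewrite dotZl rowK dotC.
by rewrite -[dot _ _]/(omega _ _) om mulr0.
Qed.

(** To compare two normal vectors along a Lagrangian immersion, pair them with
    [J] of the tangent vectors. *)
Lemma mean_curvature_eq (R : realType) n (f : 'rV[R]_n -> 'rV[R]_(n + n)) y
    (z : 'rV[R]_(n + n)) (C alpha : R) :
  row_free (tangent_mx f y) ->
  (forall i j, omega (pd i f y) (pd j f y) = 0) ->
  (forall k, C * (\sum_i \sum_j invmx (first_fund f y) i j *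
                   dot (pd i (pd j f) y) (Jmap (pd k f y))) =
             alpha * dot z (Jmap (pd k f y))) ->
  C *: mean_curvature f y = alpha *: normal_proj f y z.
Proof.
move=> fT om H; apply/eqP; rewrite -subr_eq0; apply/eqP.
rewrite -scaleNr.
apply: (Lagrangian_frame_total fT) => [i j|i|k]; rewrite !rowK //.
  rewrite dotDl !dotZl dot_suml big1 => [|k _].
    by have [-> _] := normal_projP f y z; rewrite !mulr0 addr0.
  rewrite dot_suml big1 // => j _; rewrite dotZl /second_fund.
  by have [-> _] := normal_projP f y (pd k (pd j f) y); rewrite mulr0.
rewrite dotDl !dotZl dot_suml dot_normal_proj_J //.
under eq_bigr do rewrite dot_suml.
under eq_bigr do under eq_bigr do rewrite dotZl /second_fund dot_normal_proj_J //.
by rewrite H mulNr subrr.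
Qed.

(** Contraction of two columns of a frame [(v, sigma)] of the tangent
    hyperplane of the quadric times the line with the inverse of its Gram
    matrix [g] for the weights [1 / rho] and [K]. *)
Lemma frame_contraction (R : realType) n (lam x rho : 'I_n -> R)
    (v : 'I_n -> 'I_n -> R) (sigma : 'I_n -> R) (K A : R) (g : 'M[R]_n) :
  (forall l, rho l != 0) -> K != 0 -> A != 0 ->
  (forall i, \sum_l lam l * (x l * v i l) = 0) ->
  A = \sum_l lam l ^+ 2 * x l ^+ 2 * rho l ->
  g \in unitmx ->
  (forall i j,
     g i j = (\sum_l v i l * v j l / rho l) + K * (sigma i * sigma j)) ->
  [/\ forall l, \sum_i \sum_j invmx g i j * (v i l * v j l) =
        rho l - A^-1 * (lam l * x l * rho l) ^+ 2,
      forall l, \sum_i \sum_j invmx g i j * (sigma i * v j l) = 0,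
      forall l, \sum_i \sum_j invmx g i j * (v i l * sigma j) = 0 &
      \sum_i \sum_j invmx g i j * (sigma i * sigma j) = K^-1].
Proof.
move=> rho0 K0 A0 H1 AE ug gE.
pose T : 'M[R]_(n, n + 1) := row_mx (\matrix_(i, l) v i l) (\col_i sigma i).
pose N : 'rV[R]_(n + 1) := row_mx (\row_l (lam l * x l * rho l)) 0.
pose d : 'rV[R]_(n + 1) := row_mx (\row_l (rho l)^-1) K%:M.
pose d' : 'rV[R]_(n + 1) := row_mx (\row_l rho l) K^-1%:M.
have dl l : d 0 (lshift 1 l) = (rho l)^-1 by rewrite /d row_mxEl mxE.
have dr : d 0 (rshift n 0) = K by rewrite /d row_mxEr mxE eqxx mulr1n.
have dl' l : d' 0 (lshift 1 l) = rho l by rewrite /d' row_mxEl mxE.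
have dr' : d' 0 (rshift n 0) = K^-1 by rewrite /d' row_mxEr mxE eqxx mulr1n.
have Tl i l : T i (lshift 1 l) = v i l by rewrite /T row_mxEl mxE.
have Tr i : T i (rshift n 0) = sigma i by rewrite /T row_mxEr mxE.
have Nl l : N 0 (lshift 1 l) = lam l * x l * rho l by rewrite /N row_mxEl mxE.
have Nr : N 0 (rshift n 0) = 0 by rewrite /N row_mxEr mxE.
have DD : diag_mx d *m diag_mx d' = 1%:M.
  apply/matrixP => a b; rewrite mul_diag_mx mxE [diag_mx d' _ _]mxE [RHS]mxE.
  have [->|_] := eqVneq a b; rewrite ?mulr0n ?mulr0 // !mulr1n.
  case: (split_ordP b) => l ->; first by rewrite dl dl' mulVf.
  by rewrite ord1 dr dr' mulfV.
have form m1 m2 (X : 'M[R]_(m1, n + 1)) (Y : 'M[R]_(m2, n + 1)) a b :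
    (X *m diag_mx d *m Y^T) a b =
    (\sum_l X a (lshift 1 l) * Y b (lshift 1 l) / rho l) +
    K * (X a (rshift n 0) * Y b (rshift n 0)).
  rewrite mul_mx_diag mxE big_split_ord /= big_ord1; congr (_ + _).
    apply: eq_bigr => l _; rewrite [X in X * _]mxE [Y^T _ _]mxE dl.
    by rewrite mulrAC.
  by rewrite [X in X * _]mxE [Y^T _ _]mxE dr; ring.
have TT : T *m diag_mx d *m T^T = g.
  apply/matrixP => i j; rewrite form gE !Tr; congr (_ + _).
  by apply: eq_bigr => l _; rewrite !Tl.
have TN : T *m diag_mx d *m N^T = 0.
  apply/matrixP => i j; rewrite form !ord1 Nr !mulr0 addr0 [RHS]mxE.
  rewrite -[RHS](H1 i); apply: eq_bigr => l _; rewrite Tl Nl.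
  by have := rho0 l; set r := rho l => r0; field.
have NT : N *m diag_mx d *m T^T = 0.
  apply/matrixP => i j; rewrite form !ord1 Nr mul0r mulr0 addr0 [RHS]mxE.
  rewrite -[RHS](H1 j); apply: eq_bigr => l _; rewrite Tl Nl.
  by have := rho0 l; set r := rho l => r0; field.
have NN : N *m diag_mx d *m N^T = A%:M.
  apply/matrixP => i j; rewrite form !ord1 Nr !mulr0 addr0 [RHS]mxE.
  rewrite eqxx mulr1n AE; apply: eq_bigr => l _; rewrite Nl.
  by have := rho0 l; set r := rho l => r0; field.
have := frame_completeness DD _ A0 TN NT NN; rewrite TT => /(_ ug) W.
have entry a b : \sum_i \sum_j invmx g i j * (T i a * T j b) =
    (diag_mx d' - A^-1 *: (N^T *m N)) a b.
  rewrite -W mxE exchange_big /=; apply: eq_bigr => j _.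
  rewrite [X in X * _]mxE mulr_suml; apply: eq_bigr => i _.
  by rewrite [T^T _ _]mxE; ring.
have rhs a b : (diag_mx d' - A^-1 *: (N^T *m N)) a b =
    d' 0 a *+ (a == b) - A^-1 * (N 0 a * N 0 b).
  rewrite mxE [X in _ + X]mxE [X in _ - X]mxE [(N^T *m N) a b]mxE big_ord1.
  by rewrite [N^T _ _]mxE [diag_mx d' _ _]mxE.
split=> [l|l|l|].
- have := entry (lshift 1 l) (lshift 1 l).
  under eq_bigr do under eq_bigr do rewrite !Tl.
  by move=> ->; rewrite rhs eqxx dl' Nl expr2.
- have := entry (rshift n 0) (lshift 1 l).
  under eq_bigr do under eq_bigr do rewrite Tl Tr.
  by move=> ->; rewrite rhs eq_rlshift Nr mul0r mulr0 subrr.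
- have := entry (lshift 1 l) (rshift n 0).
  under eq_bigr do under eq_bigr do rewrite Tl Tr.
  by move=> ->; rewrite rhs eq_lrshift Nr !mulr0 subrr.
- have := entry (rshift n 0) (rshift n 0).
  under eq_bigr do under eq_bigr do rewrite !Tr.
  by move=> ->; rewrite rhs eqxx Nr !mulr0 subr0 dr'.
Qed.

(** * Pointwise identities along the immersion *)

(** Real and imaginary parts of the velocity and of the acceleration of a
    profile curve [P + i Q], with [rho = 1 / (P ^ 2 + Q ^ 2)] and [q'] the
    derivative of [q]. *)
Definition velP (R : realType) (B q lam rho P Q : R) : R :=
  lam * rho * (B * P - q * Q).
Definition velQ (R : realType) (B q lam rho P Q : R) : R :=
  lam * rho * (q * P + B * Q).
Definition accP (R : realType) (B q q' lam rho P Q : R) : R :=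
  lam * (- 2 * lam * B * rho ^+ 2 * (B * P - q * Q) +
    rho * (B * velP B q lam rho P Q - (q' * Q + q * velQ B q lam rho P Q))).
Definition accQ (R : realType) (B q q' lam rho P Q : R) : R :=
  lam * (- 2 * lam * B * rho ^+ 2 * (q * P + B * Q) +
    rho * (q' * P + q * velP B q lam rho P Q + B * velQ B q lam rho P Q)).

(** One coordinate of the symplectic product of two tangent vectors. *)
Lemma profile_cross (R : realType) (B q lam rho P Q x v w s t : R) :
  rho * (P ^+ 2 + Q ^+ 2) = 1 ->
  (v * P + x * (velP B q lam rho P Q * s)) *
  (w * Q + x * (velQ B q lam rho P Q * t)) -
  (v * Q + x * (velQ B q lam rho P Q * s)) *
  (w * P + x * (velP B q lam rho P Q * t)) = lam * q * x * (v * t - w * s).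
Proof.
rewrite /velP /velQ => h; rewrite -[RHS]mulr1 -h; ring.
Qed.

(** One coordinate of the Euclidean product of two tangent vectors. *)
Lemma profile_dot (R : realType) (B q lam rho P Q x v w s t : R) :
  rho * (P ^+ 2 + Q ^+ 2) = 1 ->
  (v * P + x * (velP B q lam rho P Q * s)) *
  (w * P + x * (velP B q lam rho P Q * t)) +
  (v * Q + x * (velQ B q lam rho P Q * s)) *
  (w * Q + x * (velQ B q lam rho P Q * t)) =
  v * w / rho + lam * B * x * (v * t + w * s) +
  lam ^+ 2 * rho * (B ^+ 2 + q ^+ 2) * x ^+ 2 * (s * t).
Proof.
move=> h; have r0 : rho != 0.
  by apply: contra_eqN h => /eqP ->; rewrite mul0r eq_sym oner_eq0.
have h2 : P ^+ 2 = rho^-1 - Q ^+ 2 by rewrite -[rho^-1]mulr1 -h; field.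
have -> : (v * P + x * (velP B q lam rho P Q * s)) *
  (w * P + x * (velP B q lam rho P Q * t)) +
  (v * Q + x * (velQ B q lam rho P Q * s)) *
  (w * Q + x * (velQ B q lam rho P Q * t)) =
  (P ^+ 2 + Q ^+ 2) * (v * w + lam * rho * B * x * (v * t + w * s) +
    lam ^+ 2 * rho ^+ 2 * (B ^+ 2 + q ^+ 2) * x ^+ 2 * (s * t)).
  by rewrite /velP /velQ; ring.
by rewrite h2 subrK; field.
Qed.

(** One coordinate of the Euclidean product of a second derivative with [J] of
    a tangent vector. *)
Lemma profile_second (R : realType)
    (B q q' lam rho P Q x d vi vj vk si sj sk t : R) :
  rho * (P ^+ 2 + Q ^+ 2) = 1 ->
  let P1 := velP B q lam rho P Q in let Q1 := velQ B q lam rho P Q in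
  let P2 := accP B q q' lam rho P Q in let Q2 := accQ B q q' lam rho P Q in
  - (d * P + vj * (P1 * si) + (vi * (P1 * sj) + x * (P2 * si * sj + P1 * t))) *
    (vk * Q + x * (Q1 * sk)) +
  (d * Q + vj * (Q1 * si) + (vi * (Q1 * sj) + x * (Q2 * si * sj + Q1 * t))) *
    (vk * P + x * (P1 * sk)) =
  q * (si * (lam * (vj * vk)) + sj * (lam * (vi * vk)) - sk * (lam * (x * d)))
  + (q * t + q' * (si * sj)) * (lam * (x * vk))
  + si * sj * sk * (B * q' * (lam ^+ 2 * x ^+ 2 * rho) +
                    q * (B ^+ 2 + q ^+ 2) * (lam ^+ 3 * x ^+ 2 * rho ^+ 2)).
Proof.
move=> h P1 Q1 P2 Q2.
rewrite [LHS](_ : _ = (P ^+ 2 + Q ^+ 2) * rho * (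
  q * (si * (lam * (vj * vk)) + sj * (lam * (vi * vk)) - sk * (lam * (x * d)))
  + (q * t + q' * (si * sj)) * (lam * (x * vk))
  + si * sj * sk * (B * q' * (lam ^+ 2 * x ^+ 2 * rho) +
                    q * (B ^+ 2 + q ^+ 2) * (lam ^+ 3 * x ^+ 2 * rho ^+ 2)))).
  by rewrite [X in X * _]mulrC h mul1r.
rewrite /P2 /Q2 /accP /accQ /P1 /Q1 /velP /velQ; ring.
Qed.

(** The partial derivatives of [x_l (P_l + i Q_l)(S)], where [v i l] and
    [sigma i] are those of [x_l] and [S]. *)
Definition first_jet (R : realType) n (f : 'rV[R]_n -> 'rV[R]_(n + n)) y
    (B q : R) (lam rho P Q x : 'I_n -> R) (v : 'I_n -> 'I_n -> R)
    (sigma : 'I_n -> R) : Prop := forall i l,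
  pd i f y 0 (lshift n l) =
    v i l * P l + x l * (velP B q (lam l) (rho l) (P l) (Q l) * sigma i) /\
  pd i f y 0 (rshift n l) =
    v i l * Q l + x l * (velQ B q (lam l) (rho l) (P l) (Q l) * sigma i).

Lemma jet_omega (R : realType) n (f : 'rV[R]_n -> 'rV[R]_(n + n)) y
    (B q : R) (lam rho P Q x : 'I_n -> R) v sigma i j :
  first_jet f y B q lam rho P Q x v sigma ->
  (forall l, rho l * (P l ^+ 2 + Q l ^+ 2) = 1) ->
  (forall i, \sum_l lam l * (x l * v i l) = 0) ->
  omega (pd i f y) (pd j f y) = 0.
Proof.
move=> e1 h H1; rewrite /omega.
move: (e1 i) (e1 j); move: (pd i f y) (pd j f y) => w z ew ez; rewrite dotE.
transitivity (q * (sigma j * \sum_l lam l * (x l * v i l) -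
                   sigma i * \sum_l lam l * (x l * v j l))).
  rewrite !mulr_sumr -sumrB mulr_sumr; apply: eq_bigr => l _.
  rewrite Jmap_l Jmap_r; have [-> ->] := ew l; have [-> ->] := ez l.
  rewrite mulNr addrC (profile_cross _ _ _ _ _ _ _ _ (h l)); ring.
by rewrite !H1 !mulr0 subrr mulr0.
Qed.

Lemma jet_first_fund (R : realType) n (f : 'rV[R]_n -> 'rV[R]_(n + n)) y
    (B q : R) (lam rho P Q x : 'I_n -> R) v sigma i j :
  first_jet f y B q lam rho P Q x v sigma ->
  (forall l, rho l * (P l ^+ 2 + Q l ^+ 2) = 1) ->
  (forall i, \sum_l lam l * (x l * v i l) = 0) ->
  first_fund f y i j = (\sum_l v i l * v j l / rho l) +
    (B ^+ 2 + q ^+ 2) * (\sum_l lam l ^+ 2 * x l ^+ 2 * rho l) *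
    (sigma i * sigma j).
Proof.
move=> e1 h H1; rewrite mxE.
move: (e1 i) (e1 j); move: (pd i f y) (pd j f y) => w z ew ez; rewrite dotE.
transitivity ((\sum_l v i l * v j l / rho l) +
  B * (sigma j * \sum_l lam l * (x l * v i l) +
       sigma i * \sum_l lam l * (x l * v j l)) +
  (B ^+ 2 + q ^+ 2) * (\sum_l lam l ^+ 2 * x l ^+ 2 * rho l) *
    (sigma i * sigma j)).
  rewrite !mulr_sumr -big_split mulr_sumr mulr_suml -!big_split /=.
  apply: eq_bigr => l _.
  have [-> ->] := ew l; have [-> ->] := ez l.
  rewrite (profile_dot _ _ _ _ _ _ _ _ (h l)); ring.
by rewrite !H1 !mulr0 addr0 mulr0 addr0.
Qed.

Lemma jet_row_free (R : realType) n (f : 'rV[R]_n -> 'rV[R]_(n + n)) y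
    (u : 'rV[R]_n -> 'rV[R]_(n + 1))
    (B q C : R) (lam rho P Q x : 'I_n -> R) v sigma :
  first_jet f y B q lam rho P Q x v sigma ->
  (forall l, rho l * (P l ^+ 2 + Q l ^+ 2) = 1) ->
  q != 0 -> C != 0 -> \sum_l lam l * x l ^+ 2 = C ->
  (forall i l, pd i u y 0 (lshift 1 l) = v i l) ->
  (forall i, pd i u y 0 (rshift n 0) = sigma i) ->
  row_free (tangent_mx u y) -> row_free (tangent_mx f y).
Proof.
move=> e1 h q0 C0 HC uv us fu; apply: inj_row_free => c cT.
pose V l := \sum_i c 0 i * v i l; pose s := \sum_i c 0 i * sigma i.
have coordL l : V l * P l + x l * (velP B q (lam l) (rho l) (P l) (Q l) * s) = 0.
  have := congr1 (fun A : 'rV[R]_(n + n) => A 0 (lshift n l)) cT.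
  rewrite [RHS]mxE => <-; rewrite mxE /V /s mulr_suml !mulr_sumr -big_split /=.
  by apply: eq_bigr => i _; rewrite [in RHS]mxE; have [-> _] := e1 i l; ring.
have coordR l : V l * Q l + x l * (velQ B q (lam l) (rho l) (P l) (Q l) * s) = 0.
  have := congr1 (fun A : 'rV[R]_(n + n) => A 0 (rshift n l)) cT.
  rewrite [RHS]mxE => <-; rewrite mxE /V /s mulr_suml !mulr_sumr -big_split /=.
  by apply: eq_bigr => i _; rewrite [in RHS]mxE; have [_ ->] := e1 i l; ring.
(* Multiplying by the conjugate of P + i Q and taking imaginary parts
   eliminates V. *)
have xs l : lam l * x l * s = 0.
  have := profile_cross B q (lam l) (x l) 1 (V l) 0 s (h l).
  rewrite coordL coordR mulr0 mulr0 subrr => hx; apply: (mulfI q0).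
  by rewrite mulr0 hx; ring.
have s0 : s = 0.
  apply: (mulfI C0); rewrite mulr0 -HC mulr_suml big1 // => l _.
  by rewrite expr2 mulrA mulrAC xs mul0r.
have V0 l : V l = 0.
  have := coordL l; have := coordR l; rewrite s0 !mulr0 !addr0 => VQ VP.
  rewrite -[V l]mulr1 -(h l).
  transitivity (rho l * (V l * P l * P l + V l * Q l * Q l)); first by ring.
  by rewrite VP VQ !mul0r addr0 mulr0.
apply: (row_free_inj fu); rewrite mul0mx; apply/rowP => l; rewrite !mxE.
case: (split_ordP l) => k ->.
  by rewrite -[RHS](V0 k); apply: eq_bigr => i _; rewrite mxE uv.
by rewrite -[RHS]s0; apply: eq_bigr => i _; rewrite mxE ord1 us.
Qed.

(** The second partial derivatives of [x_l (P_l + i Q_l)(S)], where [d] and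
    [tau] are those of [x_l] and [S]. *)
Definition second_jet (R : realType) n (f : 'rV[R]_n -> 'rV[R]_(n + n)) y
    (B q q' : R) (lam rho P Q x : 'I_n -> R) (v : 'I_n -> 'I_n -> R)
    (sigma : 'I_n -> R) (d : 'I_n -> 'I_n -> 'I_n -> R)
    (tau : 'I_n -> 'I_n -> R) : Prop := forall i j l,
  pd i (pd j f) y 0 (lshift n l) = d i j l * P l +
    v j l * (velP B q (lam l) (rho l) (P l) (Q l) * sigma i) +
    (v i l * (velP B q (lam l) (rho l) (P l) (Q l) * sigma j) +
     x l * (accP B q q' (lam l) (rho l) (P l) (Q l) * sigma i * sigma j +
            velP B q (lam l) (rho l) (P l) (Q l) * tau i j)) /\
  pd i (pd j f) y 0 (rshift n l) = d i j l * Q l +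
    v j l * (velQ B q (lam l) (rho l) (P l) (Q l) * sigma i) +
    (v i l * (velQ B q (lam l) (rho l) (P l) (Q l) * sigma j) +
     x l * (accQ B q q' (lam l) (rho l) (P l) (Q l) * sigma i * sigma j +
            velQ B q (lam l) (rho l) (P l) (Q l) * tau i j)).

(** The cubic form [<h(e_i, e_j), J e_k>] of the immersion. *)
Lemma jet_cubic_form (R : realType) n (f : 'rV[R]_n -> 'rV[R]_(n + n)) y
    (B q q' : R) (lam rho P Q x : 'I_n -> R) v sigma d tau i j k :
  first_jet f y B q lam rho P Q x v sigma ->
  second_jet f y B q q' lam rho P Q x v sigma d tau ->
  (forall l, rho l * (P l ^+ 2 + Q l ^+ 2) = 1) ->
  (forall i, \sum_l lam l * (x l * v i l) = 0) ->
  (forall i j, \sum_l lam l * (v i l * v j l + x l * d i j l) = 0) ->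
  dot (pd i (pd j f) y) (Jmap (pd k f y)) =
  q * (sigma i * (\sum_l lam l * (v j l * v k l)) +
       sigma j * (\sum_l lam l * (v i l * v k l)) +
       sigma k * (\sum_l lam l * (v i l * v j l))) +
  sigma i * sigma j * sigma k *
    (B * q' * (\sum_l lam l ^+ 2 * x l ^+ 2 * rho l) +
     q * (B ^+ 2 + q ^+ 2) * (\sum_l lam l ^+ 3 * x l ^+ 2 * rho l ^+ 2)).
Proof.
move=> e1 e2 h H1 H2.
move: (e1 k) (e2 i j); move: (pd k f y) (pd i (pd j f) y) => w z ew ez.
have Hd : \sum_l lam l * (v i l * v j l) = - \sum_l lam l * (x l * d i j l).
  apply/eqP; rewrite -subr_eq0 opprK -big_split /=; apply/eqP.
  by rewrite -[RHS](H2 i j); apply: eq_bigr => l _; rewrite mulrDr.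
rewrite Hd dotE.
transitivity (
  q * (sigma i * (\sum_l lam l * (v j l * v k l)) +
       sigma j * (\sum_l lam l * (v i l * v k l)) -
       sigma k * (\sum_l lam l * (x l * d i j l))) +
  (q * tau i j + q' * (sigma i * sigma j)) * (\sum_l lam l * (x l * v k l)) +
  sigma i * sigma j * sigma k *
    (B * q' * (\sum_l lam l ^+ 2 * x l ^+ 2 * rho l) +
     q * (B ^+ 2 + q ^+ 2) * (\sum_l lam l ^+ 3 * x l ^+ 2 * rho l ^+ 2))).
  rewrite !mulr_sumr -!big_split -sumrB !mulr_sumr -!big_split /=.
  apply: eq_bigr => l _; rewrite Jmap_l Jmap_r.
  have [-> ->] := ew l; have [-> ->] := ez l.
  rewrite mulrN -mulNr.
  exact: (profile_second B q q' (lam l) (x l) (d i j l) (v i l) (v j l) (v k l)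
    (sigma i) (sigma j) (sigma k) (tau i j) (h l)).
by rewrite H1 mulr0 addr0 mulrN.
Qed.

(** Contraction with [g] commutes with linear combinations. *)
Lemma contraction_sum (R : realType) n m (g : 'M[R]_n) (c : 'I_m -> R)
    (t : 'I_n -> 'I_n -> 'I_m -> R) :
  \sum_i \sum_j g i j * (\sum_l c l * t i j l) =
  \sum_l c l * (\sum_i \sum_j g i j * t i j l).
Proof.
under eq_bigr do under eq_bigr do rewrite mulr_sumr.
under eq_bigr do rewrite exchange_big /=.
rewrite exchange_big /=; apply: eq_bigr => l _.
rewrite mulr_sumr; apply: eq_bigr => i _.
rewrite mulr_sumr; apply: eq_bigr => j _; ring.
Qed.

Lemma jet_mean_curvature (R : realType) n (f : 'rV[R]_n -> 'rV[R]_(n + n)) y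
    (B q alpha C : R) (lam rho P Q x : 'I_n -> R) v sigma d tau
    (z : 'rV[R]_(n + n)) :
  let q' := - (B ^+ 2 + q ^+ 2) / B * q * (alpha + \sum_l lam l * rho l) in
  first_jet f y B q lam rho P Q x v sigma ->
  second_jet f y B q q' lam rho P Q x v sigma d tau ->
  (forall l, rho l * (P l ^+ 2 + Q l ^+ 2) = 1) ->
  (forall l, 0 < rho l) -> (forall l, lam l != 0) ->
  B != 0 -> C != 0 -> \sum_l lam l * x l ^+ 2 = C ->
  (forall i, \sum_l lam l * (x l * v i l) = 0) ->
  (forall i j, \sum_l lam l * (v i l * v j l + x l * d i j l) = 0) ->
  (forall l, z 0 (lshift n l) = x l * P l) ->
  (forall l, z 0 (rshift n l) = x l * Q l) ->
  row_free (tangent_mx f y) ->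
  C *: mean_curvature f y = alpha *: normal_proj f y z.
Proof.
move=> q' e1 e2 h r0 lam0 B0 C0 HC H1 H2 zl zr fT.
pose A := \sum_l lam l ^+ 2 * x l ^+ 2 * rho l.
pose A3 := \sum_l lam l ^+ 3 * x l ^+ 2 * rho l ^+ 2.
pose K := (B ^+ 2 + q ^+ 2) * A.
have Bq : B ^+ 2 + q ^+ 2 != 0.
  by rewrite lt0r_neq0 // ltr_pwDl ?sqr_ge0 // exprn_even_gt0.
have A0 : A != 0.
  apply: contra_neq C0 => A0; rewrite -HC big1 // => l _.
  have ge0 i : true -> 0 <= lam i ^+ 2 * x i ^+ 2 * rho i.
    by move=> _; exact: mulr_ge0 (mulr_ge0 (sqr_ge0 _) (sqr_ge0 _)) (ltW (r0 i)).
  have := psumr_eq0P ge0 A0; move/(_ l isT)/eqP.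
  rewrite !mulf_eq0 (gt_eqF (r0 l)) (negbTE (lam0 l)) /= orbF orbb => /eqP ->.
  by rewrite expr0n mulr0.
have K0 : K != 0 by rewrite mulf_neq0.
have r0' l : rho l != 0 by rewrite lt0r_neq0.
have gE i j : first_fund f y i j =
    (\sum_l v i l * v j l / rho l) + K * (sigma i * sigma j).
  by rewrite (jet_first_fund _ _ e1 h H1).
have om i j := jet_omega i j e1 h H1.
apply: mean_curvature_eq => // k.
have ug : first_fund f y \in unitmx.
  rewrite (_ : first_fund f y = tangent_mx f y *m (tangent_mx f y)^T).
    exact: gram_unit.
  apply/matrixP => i j; rewrite !mxE /dot mxE; apply: eq_bigr => l _.
  by rewrite !mxE.
have [Wvv Wsv Wvs Wss] :=
  frame_contraction r0' K0 A0 H1 (erefl A) ug gE.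
move: (first_fund f y) ug gE Wvv Wsv Wvs Wss => g _ _ Wvv Wsv Wvs Wss.
have -> : dot z (Jmap (pd k f y)) = - (q * C * sigma k).
  move: (e1 k); move: (pd k f y) => w ew; rewrite dotE.
  transitivity (- (\sum_l q * sigma k * (lam l * x l ^+ 2))).
    rewrite -sumrN; apply: eq_bigr => l _; rewrite zl zr Jmap_l Jmap_r.
    have hc := profile_cross B q (lam l) (x l) (x l) (v k l) 0 (sigma k) (h l).
    have [-> ->] := ew l.
    transitivity (- (lam l * q * x l * (x l * sigma k - v k l * 0))).
      by rewrite -hc; ring.
    by ring.
  by rewrite -mulr_sumr HC; ring.
have -> : \sum_i \sum_j invmx g i j * dot (pd i (pd j f) y) (Jmap (pd k f y)) =
    - (alpha * q * sigma k).
  (* The four groups of terms contract to W(sigma, v), W(v, sigma), W(v, v)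
     and W(sigma, sigma), where W is the inverse Gram matrix read in the
     frame; the first two vanish. *)
  transitivity (\sum_i \sum_j (invmx g i j *
     (\sum_l (q * lam l * v k l) * (sigma i * v j l)) +
     invmx g i j * (\sum_l (q * lam l * v k l) * (v i l * sigma j)) +
     invmx g i j * (\sum_l (q * lam l * sigma k) * (v i l * v j l)) +
     sigma k * (B * q' * A + q * (B ^+ 2 + q ^+ 2) * A3) *
       (invmx g i j * (sigma i * sigma j)))).
    apply: eq_bigr => i _; apply: eq_bigr => j _.
    rewrite (jet_cubic_form i j k e1 e2 h H1 H2) -/A -/A3.
    have E1 : \sum_l q * lam l * v k l * (sigma i * v j l) =
        q * (sigma i * \sum_l lam l * (v j l * v k l)).
      by rewrite !mulr_sumr; apply: eq_bigr => l _; ring.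
    have E2 : \sum_l q * lam l * v k l * (v i l * sigma j) =
        q * (sigma j * \sum_l lam l * (v i l * v k l)).
      by rewrite !mulr_sumr; apply: eq_bigr => l _; ring.
    have E3 : \sum_l q * lam l * sigma k * (v i l * v j l) =
        q * (sigma k * \sum_l lam l * (v i l * v j l)).
      by rewrite !mulr_sumr; apply: eq_bigr => l _; ring.
    by rewrite E1 E2 E3; ring.
  under eq_bigr do rewrite !big_split /=.
  rewrite !big_split /= !contraction_sum.
  rewrite [X in X + _ + _ + _]big1 => [|l _]; last by rewrite Wsv mulr0.
  rewrite [X in _ + X + _ + _]big1 => [|l _]; last by rewrite Wvs mulr0.
  rewrite [X in _ + X](_ : _ =
    sigma k * (B * q' * A + q * (B ^+ 2 + q ^+ 2) * A3) * K^-1); last first.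
    rewrite -Wss; move: (sigma k * _) => c.
    by rewrite mulr_sumr; apply: eq_bigr => i _; rewrite mulr_sumr.
  rewrite [X in _ + X + _](_ : _ =
    q * sigma k * ((\sum_l lam l * rho l) - A^-1 * A3)); last first.
    rewrite mulrBr !mulr_sumr -sumrB; apply: eq_bigr => l _.
    by rewrite Wvv; ring.
  by rewrite /q' /K; field; rewrite A0 Bq B0.
ring.
Qed.

(** * The immersion *)

Lemma is_derive_add (R : realType) (V : normedModType R) (f g : V -> R)
    (y v : V) (df dg : R) :
  is_derive y v f df -> is_derive y v g dg ->
  is_derive y v (fun u => f u + g u) (df + dg).
Proof. by move=> hf hg; exact: is_deriveD. Qed.

Lemma is_derive_sumf (R : realType) (V : normedModType R) n
    (f : 'I_n -> V -> R) (y v : V) (df : 'I_n -> R) :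
  (forall l, is_derive y v (f l) (df l)) ->
  is_derive y v (fun u => \sum_l f l u) (\sum_l df l).
Proof.
move=> hf; apply: (is_derive_eqf _ erefl (is_derive_sum hf)) => u.
by rewrite fct_sumE.
Qed.

(** A function constant on an open set has zero derivatives there. *)
Lemma is_derive_on_cst (R : realType) m (U : set 'rV[R]_m)
    (f : 'rV[R]_m -> R) (c : R) y v d :
  open U -> U y -> (forall z, U z -> f z = c) -> is_derive y v f d -> d = 0.
Proof.
move=> oU Uy fc [_ <-].
rewrite (@near_eq_derive _ _ _ f (fun=> c)) ?derive_cst //.
by apply: (eq_on_near oU Uy) => z /set_mem /fc.
Qed.

(** The profile is fixed in this section; [q'] stands for the derivative of
    [q]. *)
Section ProfileDerivatives.
Context (R : realType) (n : nat) (B alpha : R) (lam : 'I_n -> R) (I : set R)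
  (P Q rho : 'I_n -> R -> R) (q : R -> R)
  (prof : profile B alpha lam I P Q rho q).

Let q' s := - (B ^+ 2 + q s ^+ 2) / B * q s * (alpha + \sum_j lam j * rho j s).

Lemma profile_accP l s : I s ->
  is_derive s 1 (fun t => velP B (q t) (lam l) (rho l t) (P l t) (Q l t))
    (accP B (q s) (q' s) (lam l) (rho l s) (P l s) (Q l s)).
Proof.
move=> Is; have [dP dQ dr dq _ _ _] := prof.
have c (b : R) := is_derive_const b s (1 : R).
have h := is_derive_mul (is_derive_mul (c (lam l)) (dr l s Is))
  (is_derive_add (is_derive_mul (c B) (dP l s Is))
     (is_derive_mul (c (-1)) (is_derive_mul (dq s Is) (dQ l s Is)))).
apply: (is_derive_eqf _ _ h) => [t|]; first by rewrite /velP mulN1r.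
by rewrite /accP /velP /velQ -/(q' s); ring.
Qed.

Lemma profile_accQ l s : I s ->
  is_derive s 1 (fun t => velQ B (q t) (lam l) (rho l t) (P l t) (Q l t))
    (accQ B (q s) (q' s) (lam l) (rho l s) (P l s) (Q l s)).
Proof.
move=> Is; have [dP dQ dr dq _ _ _] := prof.
have c (b : R) := is_derive_const b s (1 : R).
have h := is_derive_mul (is_derive_mul (c (lam l)) (dr l s Is))
  (is_derive_add (is_derive_mul (dq s Is) (dP l s Is))
     (is_derive_mul (c B) (dQ l s Is))).
apply: (is_derive_eqf _ _ h) => [t|]; first by rewrite /velQ.
by rewrite /accQ /velP /velQ -/(q' s); ring.
Qed.

(** The right-hand sides of the differential equations of the profile are
    polynomials in the profile, which is therefore smooth. *)
Lemma profile_Ck m (U : set 'rV[R]_m) (S : 'rV[R]_m -> R) k : open U ->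
  (forall k, Ck U k S) -> (forall y, U y -> I (S y)) ->
  forall l, Ck U k (P l \o S) /\ Ck U k (Q l \o S).
Proof.
move=> oU CS SI.
pose J : Type := ('I_n + 'I_n) + ('I_n + unit).
pose h (j : J) : R -> R := match j with
  | inl (inl l) => P l | inl (inr l) => Q l
  | inr (inl l) => rho l | inr (inr _) => q end.
pose dh (j : J) (s : R) : R := match j with
  | inl (inl l) => lam l * rho l s * (B * P l s + (-1) * (q s * Q l s))
  | inl (inr l) => lam l * rho l s * (q s * P l s + B * Q l s)
  | inr (inl l) => - 2 * lam l * B * (rho l s * rho l s)
  | inr (inr _) => - B^-1 * (B * B + q s * q s) * q s *
                   (alpha + \sum_j lam j * rho j s) end.
have main : forall k j, Ck U k (h j \o S).
  apply: (Ck_comp_family (dh := dh) oU CS SI) => [j s Is|{}k Ch j].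
    have [dP dQ dr dq _ _ _] := prof.
    case: j => [[l|l]|[l|[]]]; rewrite /h /dh.
    - by apply: is_derive_eq (dP l s Is) _; ring.
    - exact: dQ.
    - by apply: is_derive_eq (dr l s Is) _; ring.
    - by apply: is_derive_eq (dq s Is) _; rewrite !expr2; ring.
  have cP l : Ck U k (fun y => P l (S y)) := Ch (inl (inl l)).
  have cQ l : Ck U k (fun y => Q l (S y)) := Ch (inl (inr l)).
  have cr l : Ck U k (fun y => rho l (S y)) := Ch (inr (inl l)).
  have cq : Ck U k (fun y => q (S y)) := Ch (inr (inr tt)).
  have c (b : R) : Ck U k (fun=> b) := Ck_cst _ _ _.
  case: j => [[l|l]|[l|[]]]; rewrite /dh /comp.
  - apply: (CkM oU (CkM oU (c _) (cr l))).
    exact: (CkD oU (CkM oU (c _) (cP l)) (CkM oU (c _) (CkM oU cq (cQ l)))).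
  - apply: (CkM oU (CkM oU (c _) (cr l))).
    exact: (CkD oU (CkM oU cq (cP l)) (CkM oU (c _) (cQ l))).
  - exact: (CkM oU (c _) (CkM oU (cr l) (cr l))).
  - apply: (CkM oU); first apply: (CkM oU _ cq).
      by apply: (CkM oU (c _)); apply: (CkD oU (c _)); exact: CkM.
    by apply: (CkD oU (c _)); apply: (Ck_sum oU) => j; exact: (CkM oU (c _)).
by move=> l; split; [exact: main k (inl (inl l)) | exact: main k (inl (inr l))].
Qed.

End ProfileDerivatives.

(** The map [(x, s) |-> (x_j (P_j(s) + i Q_j(s)))_j]. *)
Definition profile_map (R : realType) n (P Q : 'I_n -> R -> R)
    (p : 'rV[R]_(n + 1)) : 'rV[R]_(n + n) :=
  row_mx (\row_j (p 0 (lshift 1 j) * P j (p 0 (rshift n 0))))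
         (\row_j (p 0 (lshift 1 j) * Q j (p 0 (rshift n 0)))).

Lemma profile_map_l (R : realType) n (P Q : 'I_n -> R -> R)
    (p : 'rV[R]_(n + 1)) l : profile_map P Q p 0 (lshift n l) =
  p 0 (lshift 1 l) * P l (p 0 (rshift n 0)).
Proof. by rewrite /profile_map row_mxEl mxE. Qed.

Lemma profile_map_r (R : realType) n (P Q : 'I_n -> R -> R)
    (p : 'rV[R]_(n + 1)) l : profile_map P Q p 0 (rshift n l) =
  p 0 (lshift 1 l) * Q l (p 0 (rshift n 0)).
Proof. by rewrite /profile_map row_mxEr mxE. Qed.

(** In this section [u] is a chart of the quadric times [I], with components
    [x] and [S]; [v], [sigma] are the first and [d], [tau] the second partial
    derivatives of [x], [S], and [f] is the map in this chart. *)
Section Chart.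
Context (R : realType) (n : nat) (B C alpha : R) (lam : 'I_n -> R) (I : set R)
  (P Q rho : 'I_n -> R -> R) (q : R -> R)
  (prof : profile B alpha lam I P Q rho q)
  (U : set 'rV[R]_n) (u : 'rV[R]_n -> 'rV[R]_(n + 1))
  (oU : open U) (smu : smooth_on U u)
  (uC : forall y, U y -> \sum_j lam j * u y 0 (lshift 1 j) ^+ 2 = C)
  (uI : forall y, U y -> I (u y 0 (rshift n 0))).

Let x l y := u y 0 (lshift 1 l).
Let S y := u y 0 (rshift n 0).
Let v i l y := 'D_(delta_mx 0 i : 'rV[R]_n) (x l) y.
Let sigma i y := 'D_(delta_mx 0 i : 'rV[R]_n) S y.
Let d i j l y := 'D_(delta_mx 0 i : 'rV[R]_n) (v j l) y.
Let tau i j y := 'D_(delta_mx 0 i : 'rV[R]_n) (sigma j) y.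
Let f := profile_map P Q \o u.
Let q' s := - (B ^+ 2 + q s ^+ 2) / B * q s * (alpha + \sum_j lam j * rho j s).

Let Cx k l : Ck U k (x l). Proof. exact: (smooth_onP _ oU).1. Qed.
Let CS k : Ck U k S. Proof. exact: (smooth_onP _ oU).1. Qed.

Let dx i l y : U y -> is_derive y (delta_mx 0 i) (x l) (v i l y).
Proof. by move=> Uy; have [_ [h _]] := Cx 1 l; apply: derivableP; exact: h. Qed.

Let dS i y : U y -> is_derive y (delta_mx 0 i) S (sigma i y).
Proof. by move=> Uy; have [_ [h _]] := CS 1; apply: derivableP; exact: h. Qed.

Let dv i j l y : U y -> is_derive y (delta_mx 0 i) (v j l) (d i j l y).
Proof.
move=> Uy; have [_ [_ h]] := Cx 2 l; have [_ [h' _]] := h j.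
by apply: derivableP; exact: h'.
Qed.

Let dsigma i j y : U y -> is_derive y (delta_mx 0 i) (sigma j) (tau i j y).
Proof.
move=> Uy; have [_ [_ h]] := CS 2; have [_ [h' _]] := h j.
by apply: derivableP; exact: h'.
Qed.

Let dcomp (h : R -> R) (a : R) i y : U y -> is_derive (S y) 1 h a ->
  is_derive y (delta_mx 0 i) (fun z => h (S z)) (a * sigma i y).
Proof. by move=> Uy dh; apply: is_derive_comp1 => //; case: (dS i Uy). Qed.

(** First and second derivatives of the equation of the quadric. *)
Lemma chart_constraint1 i y : U y -> \sum_l lam l * (x l y * v i l y) = 0.
Proof.
move=> Uy.
have h := is_derive_sumf (fun l => is_derive_mul (is_derive_const (lam l) y _)
  (is_derive_mul (dx i l Uy) (dx i l Uy))).
have h0 := is_derive_on_cst oU Uy uC h.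
apply: (mulfI (_ : 2 != 0 :> R)); first by rewrite pnatr_eq0.
rewrite mulr0 -[RHS]h0 mulr_sumr; apply: eq_bigr => l _; ring.
Qed.

Lemma chart_constraint2 i j y : U y ->
  \sum_l lam l * (v i l y * v j l y + x l y * d i j l y) = 0.
Proof.
move=> Uy.
have h := is_derive_sumf (fun l => is_derive_mul (is_derive_const (lam l) y _)
  (is_derive_mul (dx i l Uy) (dv i j l Uy))).
rewrite -[RHS](is_derive_on_cst oU Uy (fun z => @chart_constraint1 j z) h).
by apply: eq_bigr => l _; ring.
Qed.

Lemma chart_smooth : smooth_on U f.
Proof.
apply/(smooth_onP _ oU) => k l; have PQ := profile_Ck prof k oU CS uI.
case: (split_ordP l) => j ->.
  have -> : (fun y => f y 0 (lshift n j)) = fun y => x j y * (P j \o S) y.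
    by apply/funext => y; rewrite /f /= profile_map_l.
  by have [h _] := PQ j; exact: CkM.
have -> : (fun y => f y 0 (rshift n j)) = fun y => x j y * (Q j \o S) y.
  by apply/funext => y; rewrite /f /= profile_map_r.
by have [_ h] := PQ j; exact: CkM.
Qed.

Let pd_fE i y l : U y ->
  pd i f y 0 l = 'D_(delta_mx 0 i) (fun z => f z 0 l) y.
Proof.
by move=> Uy; apply: pd_coord; have [_ ] := chart_smooth [::] Uy.
Qed.

Lemma chart_first_jet y : U y ->
  first_jet f y B (q (S y)) lam (rho^~ (S y)) (P^~ (S y)) (Q^~ (S y))
    (x^~ y) (fun i l => v i l y) (sigma^~ y).
Proof.
move=> Uy i l; have [dP dQ _ _ _ _ _] := prof; have IS := uI Uy.
rewrite !pd_fE //; split.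
  have -> : (fun z => f z 0 (lshift n l)) = fun z => x l z * P l (S z).
    by apply/funext => z; rewrite /f /= profile_map_l.
  by have [_ ->] := is_derive_mul (dx i l Uy) (dcomp i Uy (dP l _ IS)).
have -> : (fun z => f z 0 (rshift n l)) = fun z => x l z * Q l (S z).
  by apply/funext => z; rewrite /f /= profile_map_r.
by have [_ ->] := is_derive_mul (dx i l Uy) (dcomp i Uy (dQ l _ IS)).
Qed.

Let pd_pd_fE i j y l : U y ->
  pd i (pd j f) y 0 l = 'D_(delta_mx 0 i) (fun z => pd j f z 0 l) y.
Proof.
by move=> Uy; apply: pd_coord; have [_ ] := chart_smooth [:: j] Uy.
Qed.

Lemma chart_second_jet y : U y ->
  second_jet f y B (q (S y)) (q' (S y)) lam (rho^~ (S y)) (P^~ (S y))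
    (Q^~ (S y)) (x^~ y) (fun i l => v i l y) (sigma^~ y)
    (fun i j l => d i j l y) (fun i j => tau i j y).
Proof.
move=> Uy i j l; have [dP dQ _ _ _ _ _] := prof; have IS := uI Uy.
rewrite !pd_pd_fE //; split.
  have E : {in U, (fun z => pd j f z 0 (lshift n l)) =1 fun z =>
      v j l z * P l (S z) + x l z *
      (velP B (q (S z)) (lam l) (rho l (S z)) (P l (S z)) (Q l (S z)) *
       sigma j z)}.
    by move=> z /set_mem Uz; have [-> _] := chart_first_jet Uz j l.
  rewrite (near_eq_derive _ (eq_on_near oU Uy E)).
  have dp := dcomp i Uy (dP l _ IS).
  have da := dcomp i Uy (profile_accP prof l IS).
  by have [_ ->] := is_derive_add (is_derive_mul (dv i j l Uy) dp)
    (is_derive_mul (dx i l Uy) (is_derive_mul da (dsigma i j Uy))).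
have E : {in U, (fun z => pd j f z 0 (rshift n l)) =1 fun z =>
    v j l z * Q l (S z) + x l z *
    (velQ B (q (S z)) (lam l) (rho l (S z)) (P l (S z)) (Q l (S z)) *
     sigma j z)}.
  by move=> z /set_mem Uz; have [_ ->] := chart_first_jet Uz j l.
rewrite (near_eq_derive _ (eq_on_near oU Uy E)).
have dq := dcomp i Uy (dQ l _ IS).
have da := dcomp i Uy (profile_accQ prof l IS).
by have [_ ->] := is_derive_add (is_derive_mul (dv i j l Uy) dq)
  (is_derive_mul (dx i l Uy) (is_derive_mul da (dsigma i j Uy))).
Qed.

Lemma chart_row_free y : U y -> C != 0 ->
  row_free (tangent_mx u y) -> row_free (tangent_mx f y).
Proof.
move=> Uy C0; have [_ _ _ _ h _ q0] := prof; have IS := uI Uy.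
have du i l : pd i u y 0 l = 'D_(delta_mx 0 i) (fun z => u z 0 l) y.
  by apply: pd_coord; have [_ ] := smu [::] Uy.
apply: (jet_row_free (chart_first_jet Uy) (fun l => h l _ IS) _ C0 (uC Uy)) => //.
by rewrite lt0r_neq0 // q0.
Qed.

Lemma chart_omega y i j : U y -> omega (pd i f y) (pd j f y) = 0.
Proof.
move=> Uy; have [_ _ _ _ h _ _] := prof; have IS := uI Uy.
exact: (jet_omega i j (chart_first_jet Uy) (fun l => h l _ IS)
  (fun k => chart_constraint1 k Uy)).
Qed.

Lemma chart_mean_curvature y : U y -> B != 0 -> C != 0 ->
  (forall l, lam l != 0) -> row_free (tangent_mx u y) ->
  C *: mean_curvature f y = alpha *: normal_proj f y (f y).
Proof.
move=> Uy B0 C0 lam0 fu; have [_ _ _ _ h r0 q0] := prof; have IS := uI Uy.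
apply: (jet_mean_curvature (chart_first_jet Uy) (chart_second_jet Uy)
  (fun l => h l _ IS) (fun l => r0 l _ IS) lam0 B0 C0 (uC Uy)
  (fun k => chart_constraint1 k Uy) (fun i j => chart_constraint2 i j Uy)).
- by move=> l; rewrite /f /= profile_map_l.
- by move=> l; rewrite /f /= profile_map_r.
- exact: chart_row_free.
Qed.

End Chart.

Theorem theorem1p2 (R : realType) (n : nat) (hn : (0 < n)%N)
    (B C E alpha : R) (lam a psi : 'I_n -> R) (I : set R)
    (hB : B != 0) (hC : C != 0) (hlam : forall j, lam j != 0)
    (hE : 1 < E) (ha : forall j, 0 < a j)
    (hIopen : open I) (hIconn : connected I) (hI0 : I 0)
    (hpos : forall s, I s ->
      0 < E * (\prod_k (1 + 2 * a k * B * lam k * s))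
            * expR (2 * B * alpha * s) - 1)
    (hrad : forall j s, I s -> 0 < 1 / a j + 2 * lam j * B * s) :
  let r (j : 'I_n) (s : R) : R := Num.sqrt (1 / a j + 2 * lam j * B * s) in
  let phi (j : 'I_n) (s : R) : R :=
    psi j + oriented_int 0 s (fun t : R =>
      lam j * `|B| /
        ((1 / a j + 2 * lam j * B * t) *
         Num.sqrt (E * (\prod_k (1 + 2 * a k * B * lam k * t))
                     * expR (2 * B * alpha * t) - 1))) in
  let point (x : 'rV[R]_n) (s : R) : 'rV[R]_(n + n) :=
    polar (fun j => x 0 j * r j s) (fun j => phi j s) in
  let L : set 'rV[R]_(n + n) :=
    [set z | exists (x : 'rV[R]_n) (s : R),
       [/\ \sum_j lam j * x 0 j ^+ 2 = C, I s & z = point x s]] in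
  (* the product of the quadric and I, inside R^n x R = R^(n + 1) *)
  let M : set 'rV[R]_(n + 1) :=
    [set p | \sum_j lam j * lsubmx p 0 j ^+ 2 = C /\ I (rsubmx p 0 0)] in
  let F (p : 'rV[R]_(n + 1)) : 'rV[R]_(n + n) :=
    point (lsubmx p) (rsubmx p 0 0) in
  immersed_Lagrangian M F L /\
  forall (U : set 'rV[R]_n) (u : 'rV[R]_n -> 'rV[R]_(n + 1)),
    local_param M U u -> forall y, U y ->
      C *: mean_curvature (F \o u) y =
      alpha *: normal_proj (F \o u) y (F (u y)).
Proof.
move=> r phi point L M F.
have prof := profile_explicit psi hB ha hIopen hIconn hI0 hpos hrad.
pose P j s := r j s * cos (phi j s); pose Q j s := r j s * sin (phi j s).
have FE : F = profile_map P Q.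
  apply/funext => p; apply/rowP => l; rewrite /F /point /polar.
  case: (split_ordP l) => j ->; rewrite ?profile_map_l ?profile_map_r.
    by rewrite row_mxEl !mxE mulrA.
  by rewrite row_mxEr !mxE mulrA.
have chart U u : local_param M U u ->
    [/\ open U, smooth_on U u,
      forall y, U y -> row_free (tangent_mx u y),
      forall y, U y -> \sum_j lam j * u y 0 (lshift 1 j) ^+ 2 = C &
      forall y, U y -> I (u y 0 (rshift n 0))].
  move=> [oU smu fu _ im].
  have uM y : U y -> M (u y).
    move=> Uy; have [W [_ hW]] := im U oU (fun _ h => h).
    have : (u @` U) (u y) by exists y.
    by rewrite hW => -[].
  split=> // y /uM [].
    by move=> xC _; rewrite -xC; apply: eq_bigr => j _; rewrite mxE.
  by rewrite mxE.
rewrite FE; split; last first.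
  move=> U u /chart [oU smu fu uC uI] y Uy.
  exact: (chart_mean_curvature prof oU smu uC uI Uy hB hC hlam (fu y Uy)).
split.
- exact: quadric_submanifold.
- rewrite -FE; apply/seteqP; split=> [_ [p [pC pI] <-]|_ [x [s [xC Is ->]]]].
    by exists (lsubmx p), (rsubmx p 0 0).
  exists (row_mx x s%:M).
    by rewrite /M /= row_mxKl row_mxKr mxE eqxx mulr1n.
  by rewrite /F row_mxKl row_mxKr mxE eqxx mulr1n.
- move=> U u /chart [oU smu fu uC uI].
  split; first exact: (chart_smooth prof oU smu uI).
  move=> y Uy; exact: (chart_row_free prof oU smu uC uI Uy hC (fu y Uy)).
- move=> U u /chart [oU smu fu uC uI] y Uy i j.
  exact: (chart_omega prof oU smu uC uI i j Uy).
Qed.
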